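(* Let $M$ be a compact, orientable smooth manifold of dimension $m\le n$ (possibly with boundary) such that $\Omega^1_+(M,\mathbb R^n)\neq\emptyset$. The space $\Omega^1_+(M,\mathbb R^n)$ of full-ranked $\mathbb R^n$-valued one-forms, equipped with the generalized Ebin metric $G$, is metrically and geodesically incomplete.
   Context: $\Omega^1_+(M,\mathbb R^n)$ is the open subset of the Fréchet space $\Omega^1(M,\mathbb R^n)$ of smooth $\mathbb R^n$-valued one-forms consisting of those $\alpha$ for which $\alpha(x):T_xM\to\mathbb R^n$ is injective for all $x\in M$. In local coordinates (one-forms represented at $x$ by $n\times m$ matrices) $$G_\alpha(\zeta,\eta)=\int_M \operatorname{tr}\big(\zeta_x(\alpha_x^T\alpha_x)^{-1}\eta_x^T\big)\sqrt{\det(\alpha_x^T\alpha_x)}\,dx,\qquad \zeta,\eta\in\Omega^1(M,\mathbb R^n).$$ Metric incompleteness refers to the geodesic distance of $G$ (infimum of lengths of paths); geodesic incompleteness means that some geodesic cannot be extended for all time. *)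

(* Defs.v *)
From HB Require Import structures.
From mathcomp Require Import all_boot all_order all_algebra.
From mathcomp Require Import all_classical all_reals all_analysis.

Set Implicit Arguments.
Unset Strict Implicit.
Unset Printing Implicit Defensive.

Import Order.TTheory GRing.Theory Num.Theory.
Import numFieldNormedType.Exports.

Local Open Scope classical_set_scope.
Local Open Scope ring_scope.

Section lebesgue_tuple_step.
Context {R : realType}.
Variables (m : nat) (mu : {sigma_finite_measure set (m.-tuple R) -> \bar R}).

Definition tuple_cons (p : R * m.-tuple R) : m.+1.-tuple R :=
  [tuple of p.1 :: p.2].

Definition tuple_uncons (t : m.+1.-tuple R) : R * m.-tuple R :=
  (thead t, [tuple of behead t]).

Lemma tuple_consK : cancel tuple_cons tuple_uncons.
Proof. by case=> x t; congr pair; apply: val_inj. Qed.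

Lemma measurable_tuple_cons : measurable_fun [set: R * m.-tuple R] tuple_cons.
Proof. exact: measurable_cons. Qed.

Lemma measurable_tuple_uncons :
  measurable_fun [set: m.+1.-tuple R] tuple_uncons.
Proof.
by apply: measurable_fun_pair; [exact: measurable_tnth|exact: measurable_behead].
Qed.

Definition tuple_step_measure : set (m.+1.-tuple R) -> \bar R :=
  pushforward (lebesgue_measure \x mu)%E tuple_cons.

Let step0 : tuple_step_measure set0 = 0%E.
Proof. by rewrite /tuple_step_measure /pushforward preimage_set0 measure0. Qed.

Let step_ge0 A : (0 <= tuple_step_measure A)%E.
Proof. exact: (measure_ge0 (lebesgue_measure \x mu)%E). Qed.

Let step_additive : semi_sigma_additive tuple_step_measure.
Proof.
have mp A : measurable A -> measurable (tuple_cons @^-1` A).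
  by move=> mA; rewrite -[X in measurable X]setTI; exact: measurable_tuple_cons.
move=> F mF tF mUF; rewrite /tuple_step_measure /pushforward preimage_bigcup.
apply: measure_semi_sigma_additive.
- by move=> n; exact: mp.
- apply/trivIsetP => /= i j _ _ ij; rewrite -preimage_setI.
  by move/trivIsetP : tF => /(_ _ _ _ _ ij) ->//; rewrite preimage_set0.
- by rewrite -preimage_bigcup; exact: mp.
Qed.

HB.instance Definition _ := isMeasure.Build _ _ _
  tuple_step_measure step0 step_ge0 step_additive.

Let step_sigma_finite : sigma_finite [set: m.+1.-tuple R] tuple_step_measure.
Proof.
have /sigma_finiteP[F [TF ndF Foo]] :=
  sigma_finiteT (@lebesgue_measure R : {sigma_finite_measure set _ -> \bar R}).
have /sigma_finiteP[G [TG ndG Goo]] := sigma_finiteT mu.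
exists (fun k => tuple_uncons @^-1` (F k `*` G k)).
  rewrite -preimage_bigcup -[LHS](@preimage_setT _ _ tuple_uncons).
  congr (_ @^-1` _); apply/seteqP; split=> -[x y] // _.
  have [i _ Fi] : (\bigcup_i F i) x by rewrite -TF.
  have [j _ Gj] : (\bigcup_i G i) y by rewrite -TG.
  exists (maxn i j) => //; split.
    by move: x Fi; exact/subsetPset/ndF/leq_maxl.
  by move: y Gj; exact/subsetPset/ndG/leq_maxr.
move=> k; have [mF Fk] := Foo k; have [mG Gk] := Goo k; split.
  rewrite -[X in measurable X]setTI; apply: measurable_tuple_uncons => //.
  exact: measurableX.
rewrite /tuple_step_measure /pushforward -comp_preimage.
rewrite (_ : tuple_uncons \o tuple_cons = id); last exact/funext/tuple_consK.
by rewrite preimage_id product_measure1E// lte_mul_pinfty// ge0_fin_numE.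
Qed.

HB.instance Definition _ := @Measure_isSigmaFinite.Build _ _ _
  tuple_step_measure step_sigma_finite.

End lebesgue_tuple_step.

Section lebesgue_tuple.
Context {R : realType}.

Definition tuple0_measure : set (0.-tuple R) -> \bar R := dirac [tuple].

HB.instance Definition _ := Measure.on tuple0_measure.

Let tuple0_sigma_finite : sigma_finite [set: 0.-tuple R] tuple0_measure.
Proof.
apply: fin_num_fun_sigma_finite; first by rewrite measure0.
by move=> A mA; rewrite /tuple0_measure diracE.
Qed.

HB.instance Definition _ := @Measure_isSigmaFinite.Build _ _ _
  tuple0_measure tuple0_sigma_finite.

(** The [m]-fold product of the Lebesgue measure of [R]. *)
Fixpoint lebesgue_tuple (m : nat) :
    {sigma_finite_measure set (m.-tuple R) -> \bar R} :=
  match m with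
  | 0 => tuple0_measure
  | m'.+1 => tuple_step_measure (lebesgue_tuple m')
  end.

Definition row_of_tuple m (t : m.-tuple R) : 'rV[R]_m := \row_k tnth t k.

Definition lebesgue_int m (D : set 'rV[R]_m) (f : 'rV[R]_m -> R) : R :=
  Rintegral (lebesgue_tuple m) (@row_of_tuple m @^-1` D)
    (f \o @row_of_tuple m).

End lebesgue_tuple.

Section smooth.
Context {R : realType} (m : nat).

(** [pd [:: k1; ...; kl] f] is the iterated partial derivative
    [d_k1 ... d_kl f]. *)
Definition pd (V : normedModType R) (w : seq 'I_m) (f : 'rV[R]_m -> V) :
    'rV[R]_m -> V :=
  foldr (fun k g => 'D_(delta_mx ord0 k) g) f w.

Definition smooth_open (V : normedModType R) (W : set 'rV[R]_m)
    (f : 'rV[R]_m -> V) : Prop :=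
  forall (w : seq 'I_m) x, W x ->
    {for x, continuous (pd w f)} /\
    forall k : 'I_m, derivable (pd w f) x (delta_mx ord0 k).

(** For an arbitrary set [A]: local extendability to smooth maps on open sets. *)
Definition smooth_on (V : normedModType R) (A : set 'rV[R]_m)
    (f : 'rV[R]_m -> V) : Prop :=
  forall x, A x -> exists W (g : 'rV[R]_m -> V),
    [/\ open W, W x, smooth_open W g & forall y, W y -> A y -> f y = g y].

(** The closed half-space [{x_0 >= 0}] (the point if [m = 0]). *)
Definition half_space : set 'rV[R]_m :=
  [set x | forall k : 'I_m, val k = 0%N -> 0 <= x ord0 k].

(** [J] is the derivative at [x] of [f] relative to [A], in the convention of
    [jacobian] (acting on row vectors from the right).  It is unique if [A] is
    relatively open in the half-space. *)
Definition is_jacobian (A : set 'rV[R]_m) (f : 'rV[R]_m -> 'rV[R]_m)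
    (x : 'rV[R]_m) (J : 'M[R]_m) : Prop :=
  forall e : R, 0 < e -> \forall y \near within A (nbhs x),
    `|f y - f x - (y - x) *m J| <= e * `|y - x|.

End smooth.

Arguments half_space R m : clear implicits.

(** The smooth structure is given by an arbitrary, not necessarily maximal,
    atlas.  [chart i] and [cochart i] are total functions that are meaningful
    on [dom i] and on its image only. *)
Record manifold (R : realType) (m : nat) := Manifold {
  carrier :> topologicalType;
  idx : Type;
  dom : idx -> set carrier;
  chart : idx -> carrier -> 'rV[R]_m;
  cochart : idx -> 'rV[R]_m -> carrier;
  manifold_hausdorff : hausdorff_space carrier;
  manifold_second_countable : @second_countable carrier;
  dom_open : forall i, open (dom i);
  dom_cover : forall p, exists i, dom i p;
  chart_open : forall i, exists2 O, open O &
    chart i @` dom i = O `&` half_space R m;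
  chartK : forall i p, dom i p -> cochart i (chart i p) = p;
  chart_continuous : forall i, {within dom i, continuous (chart i)};
  cochart_continuous : forall i,
    {within chart i @` dom i, continuous (cochart i)};
  transition_smooth : forall i j,
    smooth_on (chart i @` (dom i `&` dom j)) (chart j \o cochart i)
}.

Section manifold_theory.
Context {R : realType} {m : nat} (M : manifold R m).

Definition is_transition_jacobian (i j : idx M) (p : M) (J : 'M[R]_m) : Prop :=
  is_jacobian (chart i @` (dom i `&` dom j)) (chart j \o cochart i)
    (chart i p) J.

(** [o i p] tells whether the [i]-th chart is positively oriented at [p].  This
    avoids asking for an oriented atlas, whose existence is too strong a
    requirement for half-line charts in dimension one. *)
Definition orientable : Prop :=
  exists o : idx M -> M -> bool,
    (forall i p, dom i p -> \forall q \near p, o i q = o i p) /\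
    (forall i j p J, dom i p -> dom j p -> is_transition_jacobian i j p J ->
      (0 < \det J) = (o i p == o j p)).

Record adapted_cover := AdaptedCover {
  cover_size : nat;
  cover_idx : 'I_cover_size -> idx M;
  cover_set : 'I_cover_size -> set M;
  cover_open : forall k, open (cover_set k);
  cover_closure : forall k, closure (cover_set k) `<=` dom (cover_idx k);
  cover_all : forall p, exists k, cover_set k p
}.

Definition cover_piece (c : adapted_cover) (k : 'I_(cover_size c)) : set M :=
  [set p | cover_set k p /\
           forall l : 'I_(cover_size c), (l < k)%N -> ~ cover_set l p].

(** [f i] is the representative of the density in the [i]-th chart. *)
Definition density_integral_along (c : adapted_cover)
    (f : idx M -> M -> R) : R :=
  \sum_(k < cover_size c)
    lebesgue_int (chart (cover_idx k) @` cover_piece k)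
                 (f (cover_idx k) \o cochart (cover_idx k)).

(** By the change of variables formula the value does not depend on the adapted
    cover that is used, for continuous densities on a compact manifold; such a
    manifold has an adapted cover ([adapted_cover_exists]). *)
Definition density_integral (f : idx M -> M -> R) : R :=
  if pselect (exists c : adapted_cover, True) is left h
  then density_integral_along (projT1 (cid h)) f else 0.

Lemma adapted_cover_exists : compact [set: M] -> exists c : adapted_cover, True.
Proof.
move=> cptM.
have loc (p : M) : exists iU : idx M * set M,
    [/\ open iU.2, iU.2 p & closure iU.2 `<=` dom iU.1].
  have [i dip] := dom_cover p.
  have := @compact_regular _ p setT (@manifold_hausdorff _ _ M) cptM filterT.
  move=> /(_ _ (dom i)) [].
    by apply: open_nbhs_nbhs; split=> //; exact: dom_open.
  move=> B pB Bi; exists (i, B°); split=> /=; first exact: open_interior.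
    exact: pB.
  by apply: subset_trans Bi; apply: closureS; exact: interior_subset.
have [f fP] := choice loc.
have [[p0]|M0] := pselect (inhabited M); last first.
  unshelve eexists; last by [].
  by apply: (@AdaptedCover 0 (fun k : 'I_0 => False_rect _ (notF (ltn_ord k)))
    (fun=> set0)) => [[]|[]|p] //; case: M0; exists.
pose pM : ptopologicalType :=
  HB.pack (carrier M) (isPointed.Build (carrier M) p0).
have : @cover_compact pM setT by rewrite -compact_cover.
move=> /(_ M setT (fun p => (f p).2)) [||D0 _ DM].
- by move=> p _; have [] := fP p.
- by move=> p _; exists p => //; have [] := fP p.
pose D : seq M := finmap.enum_fset D0.
pose e (k : 'I_(size D)) : M := tnth (in_tuple D) k.
suff call p : exists k, (f (e k)).2 p.
  unshelve eexists; last by [].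
  apply: (@AdaptedCover (size D) (fun k => (f (e k)).1) (fun k => (f (e k)).2)).
  - by move=> k; have [] := fP (e k).
  - by move=> k; have [] := fP (e k).
  - exact: call.
have [q /= qD fq] := DM p Logic.I.
have /tnthP[k qk] : q \in in_tuple D by [].
by exists k; rewrite /e -qk.
Qed.

End manifold_theory.

Section oneforms.
Context {R : realType} {m : nat} (M : manifold R m) (n : nat).

(** A tangent vector at [p] is represented by its coordinates in each chart
    around [p], hence a section of [Hom(TM, R^n)] by an [n x m] matrix for each
    chart around each point. *)
Definition local_field : Type := idx M -> M -> 'M[R]_(n, m).

(** The value outside of the charts is normalised to [0], so that Leibniz
    equality is equality of one-forms. *)
Definition Omega1 : set local_field := [set a |
  [/\ forall i p, ~ dom i p -> a i p = 0,
      forall i, smooth_on (chart i @` dom i) (a i \o cochart i) &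
      forall i j p J, dom i p -> dom j p -> is_transition_jacobian i j p J ->
        a i p = a j p *m J^T]].

Definition Omega1_plus : set local_field := [set a | Omega1 a /\
  forall i p, dom i p -> injective (fun v : 'cV[R]_m => a i p *m v)].

Definition ebin_density (a z e : local_field) (i : idx M) (p : M) : R :=
  \tr (z i p *m invmx ((a i p)^T *m a i p) *m (e i p)^T) *
  Num.sqrt (\det ((a i p)^T *m a i p)).

Definition ebin_metric (a z e : local_field) : R :=
  density_integral (ebin_density a z e).

(** Convergence for the seminorms [sup_K |d_w a_i|], where [a_i] is the
    expression of [a] in a chart, [d_w] an iterated partial derivative, and [K]
    a compact part of the image of the chart.  The suprema are taken over the
    interior points, which are dense, because [pd] is two-sided. *)
Definition frechet_cvg (F : set_system local_field) (a : local_field) : Prop :=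
  forall (i : idx M) (w : seq 'I_m) (K : set 'rV[R]_m),
    compact K -> K `<=` chart i @` dom i ->
  forall e : R, 0 < e -> \forall b \near F,
    forall x, K x -> (chart i @` dom i)° x ->
      `|pd w ((b - a) i \o cochart i) x| <= e.

(** [v] is the (at the end points of [I], one-sided) time derivative of [c]. *)
Definition is_velocity (I : set R) (c v : R -> local_field) : Prop :=
  forall t, I t -> Omega1 (v t) /\
    frechet_cvg ((fun s => (s - t)^-1 *: (c s - c t)) @
                 within (I `\ t) (nbhs t)) (v t).

Definition smooth_curve (I : set R) (c : R -> local_field) : Prop :=
  (forall t, I t -> Omega1 (c t)) /\
  exists D : nat -> R -> local_field,
    (forall t, I t -> D 0%N t = c t) /\
    forall k, is_velocity I (D k) (D k.+1).

Definition curve_length (c v : R -> local_field) : \bar R :=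
  \int[lebesgue_measure]_(t in `[0%R, 1%R])
    (Num.sqrt (ebin_metric (c t) (v t) (v t)))%:E.

(** The distance is [+oo] between different path components. *)
Definition geodesic_dist (a b : local_field) : \bar R :=
  ereal_inf [set l | exists c v : R -> local_field,
    [/\ smooth_curve `[0, 1] c, is_velocity `[0, 1] c v,
        (forall t, t \in `[0, 1] -> Omega1_plus (c t)),
        c 0 = a /\ c 1 = b & l = curve_length c v]].

Definition metrically_complete : Prop :=
  forall u : nat -> local_field, (forall k, Omega1_plus (u k)) ->
    (forall e : R, 0 < e -> exists N : nat, forall k l : nat,
       (N <= k)%N -> (N <= l)%N -> (geodesic_dist (u k) (u l) < e%:E)%E) ->
    exists2 a, Omega1_plus a & geodesic_dist (u k) a @[k --> \oo] --> 0%E.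

Definition energy (s t : R) (c v : R -> local_field) : R :=
  2^-1 * \int[lebesgue_measure]_(r in `[s, t]) ebin_metric (c r) (v r) (v r).

(** Geodesics are the critical points of the energy on each compact
    subinterval, among curves with the same end points.  As [Omega1_plus] is
    open in the vector space [Omega1], the tangent vectors [h] to the space of
    such curves are the smooth curves in [Omega1] vanishing at the end points,
    and the derivative of the energy along [h] is computed with [c + r h]. *)
Definition geodesic (I : set R) (c : R -> local_field) : Prop :=
  [/\ smooth_curve I c, (forall t, I t -> Omega1_plus (c t)) &
      forall (s t : R), s < t -> `[s, t] `<=` I ->
      forall v, is_velocity `[s, t] c v ->
      forall h h', smooth_curve `[s, t] h -> is_velocity `[s, t] h h' ->
        h s = 0 -> h t = 0 ->
        is_derive (0 : R) (1 : R)
          (fun r : R => energy s t (c + r *: h) (v + r *: h')) (0 : R)].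

Definition geodesically_complete : Prop :=
  forall (I : set R) (c : R -> local_field), open I -> is_interval I ->
    geodesic I c ->
    exists2 c', geodesic setT c' & forall t, I t -> c' t = c t.

End oneforms.

Arguments Omega1 {R m} M n.
Arguments Omega1_plus {R m} M n.

(* Main.v *)
Require Import Defs.
From mathcomp Require Import all_boot all_order all_algebra.
From mathcomp Require Import all_classical all_reals all_analysis.
From mathcomp Require Import measurable_realfun ring lra.

(** Scaling a full-rank form [al] down to [0] is a path of finite length, and
    suitably parametrised it is a geodesic; but its limit, the zero form, does not
    have full rank. The point is to prove that this path is a geodesic and that
    no other form can be its limit.

    Write [P = A^T A] for a full-rank matrix [A], [<V, U> = tr (V P^-1 U^T)]
    ([fiber_form]) and [vol A = sqrt (det P)]; the metric is the integral of
    [<V, U> vol A], and the total volume [W] is the integral of [vol A]. The first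
    variation of [vol] in direction [V] is [<V, A> vol A] ([is_derive_vol], Jacobi's
    formula), and [<A, A> = m]. Splitting [V = mu A + (V - mu A)] therefore gives,
    along a path [A] with velocity [V] and for every real [mu],
    [G(V, V) = 2 mu W' - mu^2 m W + G(V - mu A, V - mu A)]
    ([energy_radial]), and both statements follow from this identity.

    Metric incompleteness. The best [mu] yields [W'^2 <= m W G(V, V)], so the square
    root of the volume is Lipschitz for the geodesic distance
    ([curve_length_ge]). On the other hand [(x + y s)^(2/m) al] has constant speed
    proportional to [|y|] ([ebin_metric_power_path]), so that the forms
    [(1 / (k + 1))^(2/m) al] are a Cauchy sequence. Their volumes tend to [0],
    whereas the volume of a limit would be positive.

    Geodesic incompleteness. Along the ray [t^(2/m) al] the velocity is [mu] times
    the position, with [mu = 2 / (m t)]. For a perturbation [A = ray + r h] the form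
    [V - mu A] is [r (h' - mu h)], and [2 mu W' - mu^2 m W] is the derivative of
    [(4 / m) (W / t)]. Since [h] vanishes at the end points, the energy is
    a constant plus [r^2] times a bounded quantity, hence critical at [r = 0]
    ([first_variation]). An extension of the ray to time [0] is continuous, so it
    vanishes there, which is not injective as [m > 0].

    The analysis rests on one observation: convergence of forms is controlled at
    the interior points of the image of a chart only, but every point is a limit
    of interior points along the inward normal, so the bounds hold everywhere
    ([frechet_cvg_locally_uniform]). Hence smooth curves of forms are jointly
    continuous in time and space and differentiable at each point. As [M] is
    compact, this allows differentiating the volume under the integral
    ([is_derive_volume]), the integral being taken over the measurable images of
    the pieces of a fixed finite cover. *)

Set Implicit Arguments.
Unset Strict Implicit.
Unset Printing Implicit Defensive.
Import Order.TTheory GRing.Theory Num.Theory.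
Import numFieldNormedType.Exports.
Local Open Scope classical_set_scope.
Local Open Scope ring_scope.

(** * The fibre metric and the volume of a full-rank matrix *)

Section linear_algebra.
Context {R : realType} {m n : nat}.
Implicit Types A V W : 'M[R]_(n, m).

Definition full_rank A : Prop := injective (fun v : 'cV[R]_m => A *m v).

Definition gram A : 'M[R]_m := A^T *m A.

(** The volume density of the Euclidean metric pulled back along [A]. *)
Definition vol A : R := Num.sqrt (\det (gram A)).

Definition fiber_form A V W : R := \tr (V *m invmx (gram A) *m W^T).

Definition fiber_density A V W : R := fiber_form A V W * vol A.

Lemma mxtrace_mul_tr_ge0 p q (B : 'M[R]_(p, q)) : 0 <= \tr (B *m B^T).
Proof.
apply: sumr_ge0 => i _; rewrite mxE; apply: sumr_ge0 => j _.
by rewrite mxE -expr2 sqr_ge0.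
Qed.

Lemma mxtrace_mul_tr_eq0 p q (B : 'M[R]_(p, q)) : \tr (B *m B^T) = 0 -> B = 0.
Proof.
have nn i : 0 <= (B *m B^T) i i.
  rewrite mxE; apply: sumr_ge0 => j _; by rewrite mxE -expr2 sqr_ge0.
move=> /eqP; rewrite psumr_eq0// => /allP B0.
apply/matrixP => i j; rewrite mxE.
have /eqP := B0 i (mem_index_enum i); rewrite mxE => /eqP.
rewrite psumr_eq0 => [|k _]; last by rewrite mxE -expr2 sqr_ge0.
by move=> /allP/(_ j (mem_index_enum j)); rewrite mxE -expr2 sqrf_eq0 => /eqP.
Qed.

(** The polynomial [det (x + gram A)] is monic and has no root [x >= 0], because
    a null vector [v] would satisfy [x |v|^2 + |A v|^2 = 0]; so it is positive
    at [0]. *)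
Lemma gram_det_gt0 A : full_rank A -> 0 < \det (gram A).
Proof.
move=> injA; pose p := char_poly (- gram A).
have p0 : p.[0] = \det (gram A).
  (* the two signs [(-1) ^+ m], of [char_poly] and of [- gram A], cancel *)
  rewrite horner_coef0 char_poly_det -[- gram A]scaleN1r detZ mulrA -exprD addnn.
  by rewrite -mul2n exprM sqrrN expr1n expr1n mul1r.
rewrite ltNge; apply/negP => detA.
have [b pb] := monic_Cauchy_bound (char_poly_monic (- gram A)).
have [||x /andP[x0 _]] := @poly_ivt R p 0 (Num.max 0 b).
- by rewrite le_max lexx.
- by rewrite p0 detA ltW// pb// le_max lexx orbT.
rewrite -eigenvalue_root_char => /eigenvalueP[v vA /negP]; apply; apply/eqP.
have Av0 : A *m v^T = 0.
  have vx : v *m gram A = - x *: v by rewrite scaleNr -vA mulmxN opprK.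
  have tr2 : \tr ((A *m v^T)^T *m (A *m v^T)^T^T) = - x * \tr (v *m v^T).
    rewrite trmxK trmx_mul trmxK -mulmxA (mulmxA A^T) mulmxA.
    by rewrite -[A^T *m A]/(gram A) vx -scalemxAl mxtraceZ.
  have : \tr ((A *m v^T)^T *m (A *m v^T)^T^T) = 0.
    apply/eqP; rewrite eq_le mxtrace_mul_tr_ge0 andbT tr2 mulNr oppr_le0.
    by rewrite mulr_ge0// mxtrace_mul_tr_ge0.
  by move=> /mxtrace_mul_tr_eq0/(congr1 trmx); rewrite trmxK trmx0.
apply: trmx_inj; rewrite trmx0; apply: injA.
by rewrite Av0 mulmx0.
Qed.

Lemma gram_sym A : (gram A)^T = gram A.
Proof. by rewrite trmx_mul trmxK. Qed.

Lemma gram_unit A : \det (gram A) != 0 -> gram A \in unitmx.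
Proof. by rewrite unitmxE unitfE. Qed.

Lemma vol_gt0 A : 0 < \det (gram A) -> 0 < vol A.
Proof. by rewrite sqrtr_gt0. Qed.

Lemma fiber_formC A V W : fiber_form A V W = fiber_form A W V.
Proof.
by rewrite /fiber_form -mxtrace_tr !trmx_mul trmxK trmx_inv gram_sym mulmxA.
Qed.

Lemma fiber_formDl A V1 V2 W :
  fiber_form A (V1 + V2) W = fiber_form A V1 W + fiber_form A V2 W.
Proof. by rewrite /fiber_form !mulmxDl mxtraceD. Qed.

Lemma fiber_formZl A k V W : fiber_form A (k *: V) W = k * fiber_form A V W.
Proof. by rewrite /fiber_form -!scalemxAl mxtraceZ. Qed.

Lemma fiber_formDr A V W1 W2 :
  fiber_form A V (W1 + W2) = fiber_form A V W1 + fiber_form A V W2.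
Proof. by rewrite !(fiber_formC A V) fiber_formDl. Qed.

Lemma fiber_formZr A k V W : fiber_form A V (k *: W) = k * fiber_form A V W.
Proof. by rewrite !(fiber_formC A V) fiber_formZl. Qed.

(** Since [P^-1 = P^-1 P P^-1] for [P = gram A], the form is the squared Frobenius
    norm of [V P^-1 A^T]. *)
Lemma fiber_form_ge0 A V : \det (gram A) != 0 -> 0 <= fiber_form A V V.
Proof.
move=> /gram_unit Au; pose B := V *m invmx (gram A) *m A^T.
suff -> : fiber_form A V V = \tr (B *m B^T) by exact: mxtrace_mul_tr_ge0.
rewrite /fiber_form /B !trmx_mul trmxK trmx_inv gram_sym !mulmxA.
by rewrite -(mulmxA _ A^T A) -[A^T *m A]/(gram A) (mulmxKV Au).
Qed.

Lemma fiber_form_diag A : \det (gram A) != 0 -> fiber_form A A A = m%:R.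
Proof.
move=> /gram_unit Au.
rewrite /fiber_form mxtrace_mulC mulmxA -[A^T *m A]/(gram A) mulmxV//.
exact: mxtrace1.
Qed.

Lemma gramZ k A : gram (k *: A) = k ^+ 2 *: gram A.
Proof.
rewrite /gram -scalemxAr.
have -> : (k *: A)^T = k *: A^T by apply/matrixP => i j; rewrite !mxE.
by rewrite -scalemxAl scalerA expr2.
Qed.

Lemma volZ k A : 0 <= k -> vol (k *: A) = k ^+ m * vol A.
Proof.
move=> k0; rewrite /vol gramZ detZ sqrtrM ?exprn_ge0 ?sqr_ge0//.
by rewrite -exprM mulnC exprM sqrtr_sqr ger0_norm// exprn_ge0.
Qed.

(** Completing the square around the radial direction [A], which has constant
    square [m]. The pairing of [V] with [A] is the rate of change of the volume, so
    the first two terms only depend on the volume along a path. *)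
Lemma fiber_density_radial A V mu : \det (gram A) != 0 ->
  fiber_density A V V = 2 * mu * fiber_density A V A - mu ^+ 2 * m%:R * vol A
    + fiber_density A (V - mu *: A) (V - mu *: A).
Proof.
move=> A0; rewrite /fiber_density -(scaleNr mu A) !(fiber_formDl, fiber_formDr).
rewrite !(fiber_formZl, fiber_formZr) (fiber_form_diag A0) (fiber_formC A A V).
ring.
Qed.

End linear_algebra.

(** * Limits and derivatives of matrix-valued functions *)

Section matrix_limits.
Context {R : realType} {T : Type} (F : set_system T) {FF : Filter F}.

Lemma mx_cvgP p q (A : T -> 'M[R]_(p, q)) (L : 'M[R]_(p, q)) :
  A x @[x --> F] --> L <-> (forall i j, A x i j @[x --> F] --> L i j).
Proof.
split=> [AL i j|AL].
  exact: (cvg_comp _ _ AL (@coord_continuous R p q i j L)).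
apply/cvgrPdist_lt => e e0.
have : \forall x \near F, forall ij : 'I_p * 'I_q,
    `|L ij.1 ij.2 - A x ij.1 ij.2| < e.
  have := @filter_forall T ('I_p * 'I_q)%type
    (fun ij x => `|L ij.1 ij.2 - A x ij.1 ij.2| < e) F FF.
  by apply => -[i j] /=; have /cvgrPdist_lt := AL i j; exact.
apply: filterS => x Ax; rewrite [ltLHS]mx_normrE.
by apply/bigmax_ltP; split=> // -[i j] _ /=; rewrite !mxE; exact: (Ax (i, j)).
Qed.

Lemma cvg_big_sum (I : Type) (r : seq I) (P : pred I) (f : I -> T -> R)
    (l : I -> R) : (forall i, f i x @[x --> F] --> l i) ->
  \sum_(i <- r | P i) f i x @[x --> F] --> \sum_(i <- r | P i) l i.
Proof.
move=> fl; elim: r => [|i r IH].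
  by rewrite big_nil; under eq_fun do rewrite big_nil; exact: cvg_cst.
rewrite big_cons; under eq_fun do rewrite big_cons.
by case: (P i) => //; apply: cvgD.
Qed.

Lemma cvg_big_prod (I : Type) (r : seq I) (f : I -> T -> R)
    (l : I -> R) : (forall i, f i x @[x --> F] --> l i) ->
  \prod_(i <- r) f i x @[x --> F] --> \prod_(i <- r) l i.
Proof.
move=> fl; elim: r => [|i r IH].
  by rewrite big_nil; under eq_fun do rewrite big_nil; exact: cvg_cst.
rewrite big_cons; under eq_fun do rewrite big_cons.
exact: cvgM.
Qed.

Lemma cvg_mulmx p q r (A : T -> 'M[R]_(p, q)) (B : T -> 'M[R]_(q, r))
    (LA : 'M[R]_(p, q)) (LB : 'M[R]_(q, r)) :
  A x @[x --> F] --> LA -> B x @[x --> F] --> LB ->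
  A x *m B x @[x --> F] --> LA *m LB.
Proof.
move=> /mx_cvgP hA /mx_cvgP hB; apply/mx_cvgP => i j.
rewrite mxE; under eq_fun do rewrite mxE.
by apply: cvg_big_sum => k; exact: cvgM.
Qed.

Lemma cvg_trmx p q (A : T -> 'M[R]_(p, q)) (LA : 'M[R]_(p, q)) :
  A x @[x --> F] --> LA -> (A x)^T @[x --> F] --> LA^T.
Proof.
move=> /mx_cvgP hA; apply/mx_cvgP => i j; rewrite mxE.
under eq_fun do rewrite mxE.
exact: hA.
Qed.

Lemma cvg_mxtrace p (A : T -> 'M[R]_p) (LA : 'M[R]_p) :
  A x @[x --> F] --> LA -> \tr (A x) @[x --> F] --> \tr LA.
Proof. by move=> /mx_cvgP hA; apply: cvg_big_sum. Qed.

Lemma cvg_det p (A : T -> 'M[R]_p) (LA : 'M[R]_p) :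
  A x @[x --> F] --> LA -> \det (A x) @[x --> F] --> \det LA.
Proof.
move=> /mx_cvgP hA; apply: cvg_big_sum => s; apply: cvgM; first exact: cvg_cst.
exact: cvg_big_prod.
Qed.

Lemma cvg_adjmx p (A : T -> 'M[R]_p) (LA : 'M[R]_p) :
  A x @[x --> F] --> LA -> \adj (A x) @[x --> F] --> \adj LA.
Proof.
move=> /mx_cvgP hA; apply/mx_cvgP => i j; rewrite mxE.
under eq_fun do rewrite mxE.
apply: cvgM; first exact: cvg_cst.
apply: cvg_det; apply/mx_cvgP => k l; rewrite !mxE.
under eq_fun do rewrite !mxE.
exact: hA.
Qed.

Lemma cvg_invmx p (A : T -> 'M[R]_p) (LA : 'M[R]_p) : \det LA != 0 ->
  A x @[x --> F] --> LA -> invmx (A x) @[x --> F] --> invmx LA.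
Proof.
move=> d0 hA; have hd := cvg_det hA.
have dn : \forall x \near F, \det (A x) != 0 by exact: (cvgr_neq0 _ hd).
rewrite /invmx unitmxE unitfE d0.
have : (\det (A x))^-1 *: \adj (A x) @[x --> F] --> (\det LA)^-1 *: \adj LA.
  by apply: cvgZ; [exact: cvgV|exact: cvg_adjmx].
apply: cvg_trans; apply: near_eq_cvg.
by apply: filterS dn => x dx /=; rewrite unitmxE unitfE dx.
Qed.

Section fiber.
Variables (m n : nat) (A V W : T -> 'M[R]_(n, m)) (LA LV LW : 'M[R]_(n, m)).

Lemma cvg_gram : A x @[x --> F] --> LA -> gram (A x) @[x --> F] --> gram LA.
Proof. by move=> hA; apply: cvg_mulmx => //; exact: cvg_trmx. Qed.

Lemma cvg_vol : A x @[x --> F] --> LA -> vol (A x) @[x --> F] --> vol LA.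
Proof.
move=> /cvg_gram/cvg_det h; rewrite /vol.
by apply: (continuous_cvg _ _ h); exact: sqrt_continuous.
Qed.

Lemma cvg_fiber_density : \det (gram LA) != 0 ->
  A x @[x --> F] --> LA -> V x @[x --> F] --> LV -> W x @[x --> F] --> LW ->
  fiber_density (A x) (V x) (W x) @[x --> F] --> fiber_density LA LV LW.
Proof.
move=> d0 hA hV hW; apply: cvgM; last exact: cvg_vol.
apply: cvg_mxtrace; apply: cvg_mulmx; last exact: cvg_trmx.
by apply: cvg_mulmx => //; apply: cvg_invmx => //; exact: cvg_gram.
Qed.

End fiber.
End matrix_limits.

Section matrix_derivatives.
Context {R : realType}.
Implicit Types t : R.

Lemma is_derive_big_sum t (I : Type) (r : seq I) (f : I -> R -> R)
    (d : I -> R) : (forall i, is_derive t (1 : R) (f i) (d i)) ->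
  is_derive t (1 : R) (fun x => \sum_(i <- r) f i x) (\sum_(i <- r) d i).
Proof.
move=> fd; elim: r => [|i r IH].
  by rewrite big_nil; under eq_fun do rewrite big_nil; exact: is_derive_cst.
rewrite big_cons; under eq_fun do rewrite big_cons.
exact: is_deriveD.
Qed.

Lemma is_derive_big_prod t k (f : 'I_k -> R -> R)
    (d : 'I_k -> R) : (forall i, is_derive t (1 : R) (f i) (d i)) ->
  is_derive t (1 : R) (fun x => \prod_(i < k) f i x)
    (\sum_(i < k) \prod_(j < k) (if j == i then d j else f j t)).
Proof.
elim: k f d => [|k IH] f d fd.
  by rewrite big_ord0; under eq_fun do rewrite big_ord0; exact: is_derive_cst.
under eq_fun do rewrite big_ord_recl.
have IH' := IH _ _ (fun i => fd (lift ord0 i)).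
apply: is_derive_eq.
rewrite [RHS]big_ord_recl [in RHS]big_ord_recl eqxx addrC; congr (_ + _).
  by rewrite /GRing.scale/= mulrC.
rewrite /GRing.scale/= mulr_sumr; apply: eq_bigr => i _.
by rewrite big_ord_recl (negbTE (neq_lift _ _)).
Qed.

(** Jacobi's formula: expand the derivative of the Leibniz formula row by row. *)
Lemma is_derive_det t k (P : R -> 'M[R]_k) (D : 'M[R]_k) :
  (forall i j, is_derive t (1 : R) (fun x => P x i j) (D i j)) ->
  is_derive t (1 : R) (fun x => \det (P x)) (\tr (D *m \adj (P t))).
Proof.
move=> PD; apply: is_derive_eq.
  apply: is_derive_big_sum => s; apply: (is_deriveM (is_derive_cst _ _ _)).
  by apply: is_derive_big_prod => i; exact: (PD i (s i)).
under eq_bigr do rewrite scaler0 addr0 /GRing.scale/= mulr_sumr.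
rewrite exchange_big/=; apply: eq_bigr => i _.
rewrite mxE; transitivity (\det (\matrix_(j, l)
    (if j == i then D j l else P t j l))).
  apply: eq_bigr => s _; congr (_ * _); apply: eq_bigr => j _.
  by rewrite mxE.
rewrite (expand_det_row _ i); apply: eq_bigr => j _.
rewrite !mxE eqxx; congr (_ * _); rewrite /cofactor; congr (_ * \det _).
by apply/matrixP => u v; rewrite !mxE eq_sym (negbTE (neq_lift _ _)).
Qed.

(** By Jacobi's formula: both terms of [V^T A + A^T V], the derivative of the Gram
    matrix, have the same trace against its inverse, which cancels the [1/2] of
    the square root. *)
Lemma is_derive_vol t m n (A : R -> 'M[R]_(n, m)) (V : 'M[R]_(n, m)) :
  0 < \det (gram (A t)) ->
  (forall i j, is_derive t (1 : R) (fun x => A x i j) (V i j)) ->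
  is_derive t (1 : R) (fun x => vol (A x)) (fiber_density (A t) V (A t)).
Proof.
move=> d0 AV.
have dgram i j : is_derive t (1 : R) (fun x => gram (A x) i j)
    ((V^T *m A t + (A t)^T *m V) i j).
  under eq_fun do rewrite mxE.
  apply: is_derive_eq.
    apply: is_derive_big_sum => k; under eq_fun do rewrite mxE.
    exact: is_deriveM.
  rewrite big_split/= addrC !mxE; congr (_ + _); apply: eq_bigr => k _;
    by rewrite /GRing.scale/= !mxE// mulrC.
have ddet := is_derive_det dgram.
apply: is_derive_eq.
  exact: (@is_derive1_comp _ Num.sqrt _ _ _ _ (is_derive1_sqrt d0) ddet).
have Au : gram (A t) \in unitmx by rewrite gram_unit// gt_eqF.
have adjE : \adj (gram (A t)) = \det (gram (A t)) *: invmx (gram (A t)).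
  by rewrite /invmx Au scalerA mulfV ?scale1r// gt_eqF.
have trE : \tr ((V^T *m A t + (A t)^T *m V) *m \adj (gram (A t))) =
    2 * (\det (gram (A t)) * fiber_form (A t) V (A t)).
  rewrite adjE -scalemxAr mxtraceZ mulmxDl mxtraceD.
  have -> : \tr (V^T *m A t *m invmx (gram (A t))) = fiber_form (A t) V (A t).
    by rewrite fiber_formC /fiber_form -mulmxA mxtrace_mulC.
  have -> : \tr ((A t)^T *m V *m invmx (gram (A t))) = fiber_form (A t) V (A t).
    by rewrite /fiber_form -mulmxA mxtrace_mulC.
  by ring.
rewrite /GRing.scale/= trE /fiber_density /vol.
set q := Num.sqrt _; have q0 : q != 0 by rewrite gt_eqF// sqrtr_gt0.
by rewrite -[\det _](sqr_sqrtr (ltW d0)) -/q; field.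
Qed.

End matrix_derivatives.

(** * Lebesgue measure on tuples *)

Section lebesgue_tuple_facts.
Context {R : realType}.

Definition cube m (x : 'I_m -> R) (e : R) : set (m.-tuple R) :=
  [set t | forall k, ball (x k) e (tnth t k)].

Lemma measurable_cube m (x : 'I_m -> R) (e : R) : measurable (cube x e).
Proof.
rewrite (_ : cube x e =
    \bigcap_(k in [set: 'I_m]) ((fun t : m.-tuple R => tnth t k) @^-1` ball (x k) e)).
  apply: fin_bigcap_measurable => //.
  move=> k _; rewrite -[X in measurable X]setTI.
  by apply: measurable_tnth => //; rewrite ball_itv; exact: measurable_itv.
by apply/seteqP; split=> t /= xt k; [move=> _|]; exact: xt.
Qed.

Lemma lebesgue_tuple_cube m (x : 'I_m -> R) (e : R) : 0 <= e ->
  lebesgue_tuple m (cube x e) = ((e *+ 2) ^+ m)%:E.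
Proof.
move=> e0; elim: m x => [|m IH] x.
  by rewrite /= /tuple0_measure diracE mem_set// => -[].
rewrite -[LHS]/((lebesgue_measure \x lebesgue_tuple m)%E
  (@tuple_cons R m @^-1` cube x e)).
rewrite (_ : _ @^-1` _ = ball (x ord0) e `*` cube (x \o lift ord0) e); last first.
  apply/seteqP; split=> [[y t] /= xt|[y t] /= [xy xt] k].
    split; first by have := xt ord0; rewrite tnth0.
    by move=> k /=; have := xt (lift ord0 k); rewrite tnthS.
  by case: (unliftP ord0 k) => [j|] ->; [rewrite tnthS; exact: xt|rewrite tnth0].
rewrite product_measure1E//; [|by rewrite ball_itv; exact: measurable_itv|exact: measurable_cube].
rewrite IH [X in (X * _)%E](_ : _ = (e *+ 2)%:E); last first.
  exact: lebesgue_measure_ball.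
by rewrite -EFinM exprS.
Qed.

Lemma row_of_tuple_cube m (x : 'rV[R]_m) (e : R) : 0 < e ->
  @row_of_tuple R m @^-1` ball x e = cube (x ord0) e.
Proof.
move=> e0; apply/seteqP; split=> [t [_ xt] k|t xt].
  by have := xt ord0 k; rewrite mxE.
by split=> // i j; rewrite ord1 mxE; exact: xt.
Qed.

(** An open set is the union of the countably many cubes with rational centre
    and radius [1 / N.+1] that it contains. *)
Lemma measurable_open_row m (O : set 'rV[R]_m) :
  open O -> measurable (@row_of_tuple R m @^-1` O).
Proof.
move=> oO; pose c (q : 'rV[rat]_m) : 'rV[R]_m := \row_k ratr (q ord0 k).
pose B (qN : 'rV[rat]_m * nat) : set 'rV[R]_m := ball (c qN.1) qN.2.+1%:R^-1.
rewrite (_ : _ @^-1` O = \bigcup_(qN : 'rV[rat]_m * nat)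
    if `[< B qN `<=` O >] then cube (fun k => ratr (qN.1 ord0 k)) qN.2.+1%:R^-1
    else set0); last first.
  apply/seteqP; split=> [t Ot|t [[q N] _]]; last first.
    case: asboolP => // BO qt; apply: BO; split; first by rewrite invr_gt0.
    by move=> i j; rewrite ord1 !mxE; exact: qt.
  have /nbhs_ballP[e /= e0 eO] : nbhs (row_of_tuple t) O by exact: open_nbhs_nbhs.
  have e20 : 0 < e / 2 by rewrite divr_gt0.
  near \oo => N.
  have Ne : N.+1%:R^-1 < e / 2 by near: N; exact: near_infty_natSinv_lt (PosNum e20).
  have /choice[q qP] (k : 'I_m) : exists q : rat, `|ratr q - tnth t k| < N.+1%:R^-1.
    have [|q] := @rat_in_itvoo R (tnth t k - N.+1%:R^-1) (tnth t k + N.+1%:R^-1).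
      by rewrite ltrBlDr -addrA ltrDl addr_gt0 ?invr_gt0.
    by rewrite in_itv/= -ltr_distl => ?; exists q.
  exists (\row_k q k, N) => //; case: asboolP => [_ k /=|].
    by rewrite mxE; exact: qP.
  move=> nBO; exfalso; apply: nBO => y [_ qy]; apply: eO; split => // i j; rewrite ord1.
  have := qy ord0 j; rewrite !mxE /= => qyj; rewrite /ball/=.
  rewrite (splitr e); apply: (@le_lt_trans _ _ (`|tnth t j - ratr (q j)| + `|ratr (q j) - y ord0 j|)).
    by rewrite (le_trans _ (ler_normD _ _))// addrA subrK.
  by apply: ltrD; [rewrite distrC (lt_trans (qP j))|exact: lt_trans qyj _].
apply: countable_bigcupT_measurable => // qN.
by case: ifP => // _; exact: measurable_cube.
Unshelve. all: by end_near. Qed.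

Lemma measurable_relatively_open_row m (A S : set 'rV[R]_m) :
  measurable (@row_of_tuple R m @^-1` A) -> S `<=` A ->
  (forall x, S x -> \forall y \near x, A y -> S y) ->
  measurable (@row_of_tuple R m @^-1` S).
Proof.
move=> mA SA So; rewrite (_ : S = A `&` [set x | A x -> S x]°).
  by rewrite preimage_setI; apply: measurableI => //;
    apply: measurable_open_row; exact: open_interior.
apply/seteqP; split=> [x Sx|x [Ax /interior_subset/(_ Ax)//]].
by split; [exact: SA|exact: So].
Qed.

Lemma measurable_half_space m :
  measurable (@row_of_tuple R m @^-1` half_space R m).
Proof.
have oN : open [set x : 'rV[R]_m | exists2 k : 'I_m, val k = 0%N & x ord0 k < 0].
  rewrite openE => x /= [k k0 xk].
  have : nbhs x [set y : 'rV[R]_m | y ord0 k < 0].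
    exact: (cvgr_lt _ (@coord_continuous R 1 m ord0 k x) _ xk).
  by apply: filterS => y yk; exists k.
have := measurableC (measurable_open_row oN); rewrite preimage_setC.
congr (measurable (_ @^-1` _)).
apply/seteqP; split=> x /= hx.
  by move=> k k0; rewrite leNgt; apply/negP => xk; apply: hx; exists k.
by move=> [k k0]; rewrite ltNge (hx k).
Qed.

Lemma lebesgue_tuple_bounded m (A : set 'rV[R]_m) :
  bounded_set A -> measurable (@row_of_tuple R m @^-1` A) ->
  (lebesgue_tuple m (@row_of_tuple R m @^-1` A) < +oo)%E.
Proof.
move=> /ex_strict_bound_gt0[M M0 AM] mA.
rewrite (@le_lt_trans _ _ (lebesgue_tuple m (cube (fun=> 0) M)))//; last first.
  by rewrite lebesgue_tuple_cube ?ltry// ltW.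
rewrite le_measure ?inE//; first exact: measurable_cube.
move=> t At k; rewrite /ball/= sub0r normrN.
apply: le_lt_trans (AM _ At); rewrite [leRHS]mx_normrE.
by apply/bigmax_geP; right; exists (ord0, k) => //=; rewrite mxE.
Qed.

Lemma lebesgue_tuple_interior_gt0 m (A : set 'rV[R]_m) :
  A° !=set0 -> measurable (@row_of_tuple R m @^-1` A) ->
  (0 < lebesgue_tuple m (@row_of_tuple R m @^-1` A))%E.
Proof.
move=> [x /nbhs_ballP[e /= e0 eA]] mA.
apply: (@lt_le_trans _ _ (lebesgue_tuple m (cube (x ord0) e))).
  by rewrite lebesgue_tuple_cube ?ltW// lte_fin exprn_gt0// mulrn_wgt0.
rewrite -row_of_tuple_cube// le_measure ?inE//.
  by rewrite row_of_tuple_cube//; exact: measurable_cube.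
by move=> t; exact: eA.
Qed.

End lebesgue_tuple_facts.

(** * Integration of densities over a cover of the manifold *)

Section half_space_facts.
Context {R : realType} {m : nat}.

(** The inward normal of the half-space ([0] if [m = 0]). *)
Definition inward : 'rV[R]_m := \row_k (val k == 0%N)%:R.

Definition positive_space : set 'rV[R]_m :=
  [set x | forall k : 'I_m, val k = 0%N -> 0 < x ord0 k].

Lemma positive_half_space : positive_space `<=` half_space R m.
Proof. by move=> x x0 k k0; rewrite ltW// x0. Qed.

Lemma open_positive : open positive_space.
Proof.
rewrite openE => x x0.
have : nbhs x [set y : 'rV[R]_m | forall k : 'I_m, val k = 0%N -> 0 < y ord0 k].
  have := @filter_forall 'rV[R]_m 'I_m
    (fun k (y : 'rV[R]_m) => val k = 0%N -> 0 < y ord0 k) (nbhs x) _.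
  apply => k.
  have [k0|k0] := eqVneq (val k) 0%N.
    have : nbhs x [set y : 'rV[R]_m | 0 < y ord0 k].
      exact: (cvgr_gt _ (@coord_continuous R 1 m ord0 k x) _ (x0 k k0)).
    by apply: filterS => y yk _.
  by apply: filterE => y kk; rewrite kk eqxx in k0.
exact.
Qed.

(** Boundary points of the half-space are limits of points around which the
    half-space is a neighbourhood. *)
Lemma near_inward (x : 'rV[R]_m) (V : set 'rV[R]_m) : half_space R m x ->
  nbhs x V -> \forall d \near 0^'+, V (x + d *: inward) /\
                                  positive_space (x + d *: inward).
Proof.
move=> hx xV.
have cv : (x + d *: inward) @[d --> 0^'+] --> x.
  rewrite -[X in _ --> X]addr0; apply: cvgD; first exact: cvg_cst.
  rewrite -(scale0r inward); apply: cvgZr_tmp.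
  by apply: cvg_at_right_filter; exact: cvg_id.
near=> d; split; first by near: d; exact: cv.
move=> k k0; rewrite !mxE k0 eqxx mulr1 ltr_wpDl ?hx//.
Unshelve. all: by end_near. Qed.

End half_space_facts.
Arguments inward {R} m.

Section continuity_on.
Context {R : realType} {m : nat} (M : manifold R m).

(** Continuity of chart-wise data at the points singled out by [D]: either all
    points of the chart domains, or only those of the closures of a cover. *)
Definition cont_on (D : idx M -> set M) (V : topologicalType)
    (f : idx M -> M -> V) : Prop :=
  forall i p, D i p -> {for p, continuous (f i)}.

Definition cont_family_on (D : idx M -> set M) (V T : topologicalType)
    (K : set T) (F : T -> idx M -> M -> V) : Prop :=
  forall t i p, K t -> D i p ->
    {for (t, p), continuous (fun z : T * M => F z.1 i z.2)}.

Lemma cont_family_on_at D (V T : topologicalType) (K : set T)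
    (F : T -> idx M -> M -> V) t :
  cont_family_on D K F -> K t -> cont_on D (F t).
Proof.
move=> cF Kt i p ip; have := cF t i p Kt ip.
move=> /(cvg_comp (fun q : M => (t, q)) (fun z : T * M => F z.1 i z.2)); apply.
by apply: cvg_pair => /=; [exact: cvg_cst|exact: cvg_id].
Qed.

Lemma cont_on_sub D D' (V : topologicalType) (f : idx M -> M -> V) :
  (forall i, D' i `<=` D i) -> cont_on D f -> cont_on D' f.
Proof. by move=> DD' cf i p /DD'; exact: cf. Qed.

Lemma cont_family_on_sub D D' (V T : topologicalType) (K : set T)
    (F : T -> idx M -> M -> V) :
  (forall i, D' i `<=` D i) -> cont_family_on D K F -> cont_family_on D' K F.
Proof. by move=> DD' cF t i p Kt /DD'; exact: cF. Qed.

Lemma cont_on_cst D (a : R) : cont_on D (fun _ _ => a).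
Proof. by move=> i p ip; exact: cvg_cst. Qed.

Lemma cont_onD D (f g : idx M -> M -> R) : cont_on D f -> cont_on D g ->
  cont_on D (fun i p => f i p + g i p).
Proof. by move=> cf cg i p ip; apply: cvgD; [exact: cf|exact: cg]. Qed.

Lemma cont_onZ D (a : R) (f : idx M -> M -> R) :
  cont_on D f -> cont_on D (fun i p => a * f i p).
Proof. by move=> cf i p ip; apply: cvgM; [exact: cvg_cst|exact: cf]. Qed.

End continuity_on.

Section integration.
Context {R : realType} {m : nat} (M : manifold R m).
Hypothesis cptM : compact [set: M].
Variable c : adapted_cover M.

Local Notation J := (density_integral_along c).

Implicit Types f g : idx M -> M -> R.

(** The integral only sees points of the cover. Unlike the domain of a chart, the
    closure of a member of the cover is compact, and this is what turns
    continuity into uniform bounds. *)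
Definition covered (i : idx M) : set M :=
  [set p | exists2 k : 'I_(cover_size c), cover_idx k = i & closure (cover_set k) p].

Lemma covered_dom i : covered i `<=` dom i.
Proof. by move=> p [k <-]; exact: cover_closure. Qed.

Lemma covered_closure (k : 'I_(cover_size c)) :
  closure (cover_set k) `<=` covered (cover_idx k).
Proof. by move=> p kp; exists k. Qed.

Lemma covered_set (k : 'I_(cover_size c)) : cover_set k `<=` covered (cover_idx k).
Proof. by move=> p kp; apply: covered_closure; exact: subset_closure. Qed.

Lemma chart_inj (i : idx M) (p q : M) :
  dom i p -> dom i q -> chart i p = chart i q -> p = q.
Proof. by move=> ip iq pq; rewrite -(chartK ip) pq chartK. Qed.

Lemma near_cochart (i : idx M) (p : M) (W : set M) : dom i p -> nbhs p W ->
  \forall y \near chart i p, (chart i @` dom i) y -> W (cochart i y).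
Proof.
move=> ip pW.
have /subspace_continuousP/(_ (chart i p)) := @cochart_continuous _ _ M i.
move=> /(_ (ex_intro2 _ _ p ip erefl)) cv.
have WW : nbhs (cochart i (chart i p)) W by rewrite chartK.
exact: (cv W WW).
Qed.

Lemma measurable_chart_image (i : idx M) (W : set M) : open W -> W `<=` dom i ->
  measurable (@row_of_tuple R m @^-1` (chart i @` W)).
Proof.
move=> oW Wi; apply: (@measurable_relatively_open_row _ _ (chart i @` dom i)).
- have [Q oQ ->] := @chart_open _ _ M i; rewrite preimage_setI.
  by apply: measurableI; [exact: measurable_open_row|exact: measurable_half_space].
- by move=> _ [p Wp <-]; exists p => //; exact: Wi.
- move=> _ [p Wp <-].
  have : \forall y \near chart i p, (chart i @` dom i) y -> W (cochart i y).
    by apply: near_cochart; [exact: Wi|exact: open_nbhs_nbhs].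
  apply: filterS => y yW /[dup] /yW + [q iq qy]; rewrite -qy chartK//; exists q.
Qed.

Lemma chart_image_interior (i : idx M) (W : set M) : open W ->
  W `<=` dom i -> W !=set0 -> (chart i @` W)° !=set0.
Proof.
move=> oW Wi [p Wp]; have ip := Wi p Wp.
have [Q oQ imE] := @chart_open _ _ M i.
have [Qx hx] : (Q `&` half_space R m) (chart i p) by rewrite -imE; exists p.
have : \forall y \near chart i p, (chart i @` dom i) y -> W (cochart i y).
  by apply: near_cochart => //; exact: open_nbhs_nbhs.
move=> nW; have nQ : nbhs (chart i p) Q by exact: open_nbhs_nbhs.
have nV := @nbhs_interior _ _ _ (@filterI _ (nbhs (chart i p)) _ _ _ nW nQ).
have [y [[yV y0] _]] := filter_ex (filterI (near_inward hx (nV _)) (nbhs_right_gt 0)).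
exists (chart i p + y *: inward m).
have := @filterI _ (nbhs (chart i p + y *: inward m)) (nbhs_filter _) _ _ yV (open_nbhs_nbhs (conj (@open_positive R m) y0)).
apply: filterS => z [[zW zQ] z0].
have : (chart i @` dom i) z by rewrite imE; split=> //; exact: positive_half_space.
by move=> /[dup] /zW + [q iq qz]; rewrite -qz chartK//; exists q.
Qed.

Definition piece_image (k : 'I_(cover_size c)) : set (m.-tuple R) :=
  @row_of_tuple R m @^-1` (chart (cover_idx k) @` cover_piece k).

Lemma cover_set_dom (k : 'I_(cover_size c)) : cover_set k `<=` dom (cover_idx k).
Proof. by move=> p kp; apply: cover_closure; exact: subset_closure. Qed.

(** A piece is an open set minus finitely many open sets, and charts are injective
    homeomorphisms onto their images. *)
Lemma measurable_piece_image k : measurable (piece_image k).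
Proof.
rewrite /piece_image (_ : chart _ @` _ = chart (cover_idx k) @` cover_set k `\`
  \bigcup_(l in [set l : 'I_(cover_size c) | (l < k)%N])
    chart (cover_idx k) @` (cover_set k `&` cover_set l)).
  rewrite setDE preimage_setI -preimage_setC preimage_bigcup -setDE.
  apply: measurableD.
    by apply: measurable_chart_image; [exact: cover_open|exact: cover_set_dom].
  apply: fin_bigcup_measurable => // l lk; apply: measurable_chart_image.
    by apply: openI; exact: cover_open.
  by move=> p [kp _]; exact: cover_set_dom.
apply/seteqP; split=> [_ [p [kp nl] <-]|_ [[p kp <-] nl]].
  split; first by exists p.
  move=> [l lk [q [kq lq] qp]]; apply: (nl l lk).
  by rewrite -(chart_inj (cover_set_dom kq) (cover_set_dom kp) qp).
exists p => //; split=> // l lk lp; apply: nl; exists l => //.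
by exists p.
Qed.

(** The bound is uniform over time and space, as a dominating function for the
    theorems on parametric integrals. *)
Lemma cont_family_bounded (T : topologicalType) (K : set T)
    (F : T -> idx M -> M -> R) :
  compact K -> cont_family_on covered K F ->
  exists2 C : R, 0 < C & forall t (k : 'I_(cover_size c)) p, K t ->
    closure (cover_set k) p -> `|F t (cover_idx k) p| <= C.
Proof.
move=> cK cF.
have bnd (k : 'I_(cover_size c)) : exists C : R, forall t p, K t ->
    closure (cover_set k) p -> `|F t (cover_idx k) p| <= C.
  have cKc : compact (K `*` closure (cover_set k)).
    apply: compact_setX => //; apply: (subclosed_compact _ cptM) => //.
    exact: closed_closure.
  have cont : {within K `*` closure (cover_set k),
      continuous (fun z : T * M => F z.1 (cover_idx k) z.2)}.
    apply: continuous_in_subspaceT => -[t p] /set_mem[/= Kt kp].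
    by apply: cF => //; exact: covered_closure.
  have /compact_bounded/ex_strict_bound_gt0[C C0 FC] := continuous_compact cont cKc.
  by exists C => t p Kt kp; apply/ltW/FC; exists (t, p).
have /choice[C CP] := bnd.
(* one bound for all members of the cover, and positive even if there are none *)
exists (1 + \sum_k `|C k|).
  by rewrite ltr_pwDl// sumr_ge0.
move=> t k p Kt kp; rewrite (le_trans (CP k t p Kt kp))// (le_trans (ler_norm _))//.
rewrite (bigD1 k)//= addrCA lerDl addr_ge0//.
exact: sumr_ge0.
Qed.

Lemma lebesgue_piece_image_lty k : (lebesgue_tuple m (piece_image k) < +oo)%E.
Proof.
apply: lebesgue_tuple_bounded; last exact: measurable_piece_image.
have : bounded_set (chart (cover_idx k) @` closure (cover_set k)).
  apply: compact_bounded; apply: continuous_compact.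
    apply: continuous_subspaceW (@chart_continuous _ _ M (cover_idx k)).
    exact: cover_closure.
  by apply: (subclosed_compact _ cptM) => //; exact: closed_closure.
move=> [C [Cr CP]]; exists C; split=> // y Cy _ [p [kp _] <-].
by apply: CP => //; exists p => //; exact: subset_closure.
Qed.

Lemma measurable_density f k : cont_on covered f ->
  measurable_fun (piece_image k)
    ((f (cover_idx k) \o cochart (cover_idx k)) \o @row_of_tuple R m).
Proof.
move=> cf; set i := cover_idx k.
move=> mE; apply: (measurability _ (RGenOpens.measurableE R)) => //.
move=> _ [_ [a [b ->] <-]].
rewrite (_ : _ `&` _ = piece_image k `&` @row_of_tuple R m @^-1`
    (chart i @` (cover_set k `&` f i @^-1` `]a, b[))).
  apply: measurableI => //; apply: measurable_chart_image => [|p [/cover_set_dom]//].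
  rewrite openE => p [kp fp].
  have h1 : nbhs p (cover_set k).
    by apply: open_nbhs_nbhs; split=> //; exact: cover_open.
  have h2 : nbhs p (f i @^-1` `]a, b[).
    by apply: (cf i p (covered_set kp)); apply: open_nbhs_nbhs; split.
  exact: (@filterI _ (nbhs p) _ _ _ h1 h2).
apply/seteqP; split=> t [Et] /=.
  move=> ft; split=> //; have [p [kp _] pt] := Et.
  exists p => //; split=> //=.
  by move: ft; rewrite -pt chartK//; exact: cover_set_dom.
move=> [p [kp fp] pt]; split=> //; rewrite -pt chartK//.
exact: cover_set_dom.
Qed.

Lemma integrable_density f k : cont_on covered f ->
  (lebesgue_tuple m).-integrable (piece_image k)
    (EFin \o ((f (cover_idx k) \o cochart (cover_idx k)) \o @row_of_tuple R m)).
Proof.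
move=> cf; apply: measurable_bounded_integrable.
- exact: measurable_piece_image.
- exact: lebesgue_piece_image_lty.
- exact: measurable_density.
have cF : cont_family_on covered [set (0 : R)] (fun=> f).
  move=> t i p _ ip; apply: (@cvg_comp _ _ _ snd (f i)); last exact: (cf i p ip).
  exact: cvg_snd.
have [C C0 fC] := cont_family_bounded (@compact_set1 _ 0) cF.
exists C; split; first exact: num_real.
move=> x Cx t [p [kp _] pt] /=; rewrite -pt chartK; last exact: cover_set_dom.
by rewrite (le_trans _ (ltW Cx))//; apply: (fC 0) => //; exact: subset_closure.
Qed.

Lemma density_integral_alongE f :
  J f = \sum_k \int[lebesgue_tuple m]_(t in piece_image k)
    ((f (cover_idx k) \o cochart (cover_idx k)) \o @row_of_tuple R m) t.
Proof. by []. Qed.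

Lemma eq_density_integral f g : (forall i p, covered i p -> f i p = g i p) ->
  J f = J g.
Proof.
move=> fg; apply: eq_bigr => k _; apply: eq_Rintegral => t /set_mem[p [kp _] pt].
by rewrite /= -pt chartK ?fg//; [exact: covered_set|exact: cover_set_dom].
Qed.

Lemma density_integralD f g : cont_on covered f -> cont_on covered g ->
  J (fun i p => f i p + g i p) = J f + J g.
Proof.
move=> cf cg; rewrite !density_integral_alongE -big_split/=.
apply: eq_bigr => k _.
by rewrite -RintegralD//; [exact: measurable_piece_image|exact: integrable_density..].
Qed.

Lemma density_integralZ a f : cont_on covered f ->
  J (fun i p => a * f i p) = a * J f.
Proof.
move=> cf; rewrite !density_integral_alongE mulr_sumr.
apply: eq_bigr => k _.
by rewrite -RintegralZl//; [exact: measurable_piece_image|exact: integrable_density..].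
Qed.

Lemma density_integral_ge0 f : (forall i p, covered i p -> 0 <= f i p) -> 0 <= J f.
Proof.
move=> f0; apply: sumr_ge0 => k _; apply: Rintegral_ge0 => t [p [kp _] pt].
by rewrite /= -pt chartK ?f0//; [exact: covered_set|exact: cover_set_dom].
Qed.

(** The first non-empty member of the cover is a whole piece, and its image has
    non-empty interior. *)
Lemma density_integral_gt0 f : (0 < m)%N -> [set: M] !=set0 -> cont_on covered f ->
  (forall i p, covered i p -> 0 < f i p) -> 0 < J f.
Proof.
move=> m0 [p0 _] cf f0.
pose ne := [pred k : 'I_(cover_size c) | `[< cover_set k !=set0 >]].
have [k0 k0p] := @cover_all _ _ _ c p0.
have k0ne : ne k0 by apply/asboolP; exists p0.
case: (@arg_minnP _ k0 ne (fun k => k : nat) k0ne) => k /asboolP[p kp] kmin.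
rewrite density_integral_alongE (bigD1 k)//=; apply: ltr_pwDl; last first.
  apply: sumr_ge0 => l _; apply: Rintegral_ge0 => t [q [lq _] qt].
  by rewrite /= -qt chartK ?ltW ?f0//; [exact: covered_set|exact: cover_set_dom].
have pieceE : cover_piece k = cover_set k.
  apply/seteqP; split=> [q []//|q kq]; split=> // l lk lq.
  have /kmin : ne l by apply/asboolP; exists q.
  by rewrite leqNgt lk.
have mE := measurable_piece_image k.
rewrite lt_neqAle Rintegral_ge0 ?andbT; last first.
  by move=> t [q [kq _] qt]; rewrite /= -qt chartK ?ltW ?f0//; [exact: covered_set|exact: cover_set_dom].
apply/eqP => /esym J0.
set g := ((f (cover_idx k) \o cochart (cover_idx k)) \o @row_of_tuple R m) in J0.
have gE t : piece_image k t -> 0 < g t.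
  by move=> [q [kq _] qt]; rewrite /g/= -qt chartK ?f0//; [exact: covered_set|exact: cover_set_dom].
have ig : (lebesgue_tuple m).-integrable (piece_image k) (EFin \o g).
  exact: integrable_density.
have : (\int[lebesgue_tuple m]_(t in piece_image k) (g t)%:E = 0)%E.
  rewrite -[LHS]fineK; last exact: integrable_fin_num.
  by rewrite -[fine _]/(Rintegral _ _ _) J0.
move=> int0.
have /ae_eq_integral_abs : (\int[lebesgue_tuple m]_(t in piece_image k)
    `|(EFin \o g) t| = 0)%E.
  rewrite -[RHS]int0; apply: eq_integral => t /set_mem Et /=.
  by rewrite ger0_norm// ltW// gE.
move=> /(_ mE (measurable_int _ ig))[N [mN N0 EN]].
have : (lebesgue_tuple m (piece_image k) <= 0)%E.
  rewrite -N0 le_measure ?inE// => t Et; apply: EN => /= gt0.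
  by have := gE t Et; move: (gt0 Et) => [->]; rewrite ltxx.
apply/negP; rewrite -ltNge; apply: lebesgue_tuple_interior_gt0 => //.
rewrite pieceE; apply: chart_image_interior => //; [exact: cover_open| |by exists p].
exact: cover_set_dom.
Qed.

Lemma continuous_density_integral (F : R -> idx M -> M -> R) :
  cont_family_on covered [set: R] F ->
  continuous (fun t => J (F t)).
Proof.
move=> cF t; rewrite /continuous_at.
apply: cvg_big_sum => k.
have [C C0 FC] := cont_family_bounded (@segment_compact _ (t - 1) (t + 1))
  (fun s i p _ => cF s i p Logic.I).
have tI : t \in `]t - 1, t + 1[%classic.
  by rewrite inE/= in_itv/= ltrBlDr !ltrDl ltr01.
apply: (@continuity_under_integral _ _ _ (lebesgue_tuple m)
  (fun s => (F s (cover_idx k) \o cochart (cover_idx k)) \o @row_of_tuple R m)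
  (piece_image k) (measurable_piece_image k) (t - 1) (t + 1) _ _ (fun=> C)) => //.
- move=> s _; apply: integrable_density; exact: (cont_family_on_at cF).
- apply: aeW => y [p [kp _] py] s _ /=; rewrite -py chartK; last exact: cover_set_dom.
  have := cF s (cover_idx k) p Logic.I (covered_set kp).
  move=> /(cvg_comp (fun s : R => (s, p)) (fun z : R * M => F z.1 (cover_idx k) z.2)); apply.
  exact: (cvg_pair (@cvg_id _ (nbhs s)) (cvg_cst p)).
- exact: (@integrable_density (fun _ _ => C) k (@cont_on_cst _ _ _ _ C)).
- move=> s /subset_itv_oo_cc sI; apply: aeW => y [p [kp _] py] /=.
  by rewrite -py chartK; [apply: FC => //; exact: subset_closure|exact: cover_set_dom].
Qed.

Lemma is_derive_density_integral F G (u v t C : R) : t \in `]u, v[ -> 0 <= C ->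
  (forall s, s \in `]u, v[ -> cont_on covered (F s)) ->
  (forall s i p, s \in `]u, v[ -> covered i p ->
     is_derive s (1 : R) (fun x => F x i p) (G s i p)) ->
  (forall s (k : 'I_(cover_size c)) p, s \in `]u, v[ -> cover_set k p ->
     `|G s (cover_idx k) p| <= C) ->
  is_derive t (1 : R) (fun x => J (F x)) (J (G t)).
Proof.
move=> tI C0 cF dF GC; apply: is_derive_big_sum => k.
pose f s := (F s (cover_idx k) \o cochart (cover_idx k)) \o @row_of_tuple R m.
have dE s y : s \in `]u, v[ -> piece_image k y ->
    is_derive s (1 : R) (f ^~ y)
      (((G s (cover_idx k) \o cochart (cover_idx k)) \o @row_of_tuple R m) y).
  move=> sI [p [kp _] py]; rewrite /f/= -py chartK; last exact: cover_set_dom.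
  by apply: dF => //; exact: covered_set.
have d1E s y : s \in `]u, v[ -> piece_image k y -> partial1of2 f s y =
    ((G s (cover_idx k) \o cochart (cover_idx k)) \o @row_of_tuple R m) y.
  by move=> sI Ey; rewrite partial1of2E; have := dE s y sI Ey => ?; rewrite derive_val.
have H1 : forall x, `]u, v[%classic x ->
    (lebesgue_tuple m).-integrable (piece_image k) (EFin \o f x).
  by move=> s sI; apply: integrable_density; exact: cF.
have H2 x y : `]u, v[%classic x -> piece_image k y -> derivable (f ^~ y) x 1.
  by move=> xI Ey; have [] := dE x y xI Ey.
have H3 : (lebesgue_tuple m).-integrable (piece_image k) 
    (EFin \o (fun _ : m.-tuple R => C)).
  exact: (@integrable_density (fun _ _ => C) k (@cont_on_cst _ _ _ _ C)).
have H4 x y : `]u, v[%classic x -> piece_image k y ->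
    `|partial1of2 f x y| <= (fun=> C) y.
  move=> xI Ey; rewrite d1E//; move: Ey => [p [kp _] py] /=; rewrite -py chartK.
    exact: GC.
  exact: cover_set_dom.
have mE := measurable_piece_image k.
apply: DeriveDef.
  exact: (@derivable_under_integral _ _ _ (lebesgue_tuple m) f _ mE t u v tI H1
    H2 (fun=> C) (fun=> C0) H3 H4).
rewrite -derive1E (@differentiation_under_integral _ _ _ (lebesgue_tuple m) f _ mE
  t u v tI H1 H2 (fun=> C) (fun=> C0) H3 H4).
by apply: eq_Rintegral => y /set_mem Ey; rewrite d1E.
Qed.

End integration.

(** * From the Frechet topology to joint continuity *)

Section frechet.
Context {R : realType} {m n : nat} (M : manifold R m).

Local Notation field := (local_field M n).
Local Notation cont_section := (cont_on (@dom R m M)).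
Implicit Types a b : field.

Lemma near_chart (i : idx M) p (W : set 'rV[R]_m) : dom i p ->
  nbhs (chart i p) W -> \forall q \near p, W (chart i q).
Proof.
move=> ip pW.
have := @chart_continuous _ _ M i; rewrite continuous_open_subspace; last first.
  exact: dom_open.
by move=> /(_ p (mem_set ip)); apply.
Qed.

Lemma smooth_on_cont_section a :
  (forall i, smooth_on (chart i @` dom i) (a i \o cochart i)) -> cont_section a.
Proof.
move=> sa i p ip.
have [W [g [oW Wp sg ag]]] := sa i (chart i p) (ex_intro2 _ _ p ip erefl).
have cg : {for chart i p, continuous g} by have [] := sg [::] _ Wp.
have nW : \forall q \near p, W (chart i q).
  by apply: near_chart => //; exact: open_nbhs_nbhs.
have nd : nbhs p (dom i) by apply: open_nbhs_nbhs; split=> //; exact: dom_open.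
have agE q : dom i q -> W (chart i q) -> a i q = g (chart i q).
  by move=> iq Wq; rewrite -ag//=; [rewrite chartK|exists q].
rewrite /prop_for /continuous_at (agE p ip Wp).
apply: (@cvg_trans _ ((g \o chart i) @ p)).
  apply: near_eq_cvg; near=> q; rewrite /= agE//; near: q => //.
move=> B /cg gB.
exact: near_chart ip gB.
Unshelve. all: by end_near. Qed.

Lemma Omega1_cont a : Omega1 M n a -> cont_section a.
Proof. by move=> [_ sa _]; exact: smooth_on_cont_section. Qed.

Lemma cont_fieldB a b : cont_section a -> cont_section b -> cont_section (a - b).
Proof. by move=> ca cb i p ip; exact: cvgB (ca i p ip) (cb i p ip). Qed.

Lemma cont_fieldZ (k : R) a : cont_section a -> cont_section (k *: a).
Proof. by move=> ca i p ip; exact: cvgZ (cvg_cst k) (ca i p ip). Qed.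

(** Every point of the image of a chart is a limit of interior points, along the
    inward normal; so the uniform bounds on interior points that define the
    Frechet topology extend to the boundary. *)
Lemma frechet_cvg_locally_uniform (T : Type) (F : set_system T) {FF : Filter F}
    (b : T -> field) a : (\forall s \near F, cont_section (b s)) ->
  cont_section a -> frechet_cvg (b @ F) a ->
  forall (i : idx M) p, dom i p -> exists2 N : set M, nbhs p N &
    forall e : R, 0 < e -> \forall s \near F, forall q, N q -> dom i q ->
      `|b s i q - a i q| <= e.
Proof.
move=> cb ca ba i p ip; set x0 := chart i p.
have [Q oQ imE] := @chart_open _ _ M i.
have [Qx hx] : (Q `&` half_space R m) x0 by rewrite -imE; exists p.
have /nbhs_ballP[r /= r0 rQ] : nbhs x0 Q by exact: open_nbhs_nbhs.
have r20 : 0 < r / 2 by rewrite divr_gt0.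
(* [K] is a compact box around the chart point, cut by the half-space *)
pose lo (k : 'I_m) := if val k == 0%N then Num.max 0 (x0 ord0 k - r / 2)
                      else x0 ord0 k - r / 2.
pose K : set 'rV[R]_m :=
  [set v | forall k, `[lo k, x0 ord0 k + r / 2]%classic (v ord0 k)].
have cK : compact K.
  apply: (@rV_compact R^o m (fun k => `[lo k, x0 ord0 k + r / 2]%classic)) => k.
  exact: segment_compact.
have Kim : K `<=` chart i @` dom i.
  rewrite imE => v Kv; split.
    apply: rQ; split=> // i0 k; rewrite ord1; have := Kv k.
    rewrite /= in_itv/= => /andP[l u]; rewrite /ball/= ltr_distlC.
    apply/andP; split; last by rewrite (le_lt_trans u)// ltrD2l gtr_pMr// invf_lt1 ?ltr1n.
    apply: (@lt_le_trans _ _ (x0 ord0 k - r / 2)).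
      by rewrite ltrD2l ltrN2 gtr_pMr// invf_lt1 ?ltr1n.
    apply: le_trans l; rewrite /lo; case: ifP => // _; by rewrite le_max lexx orbT.
  move=> k k0; have := Kv k; rewrite /= in_itv/= => /andP[+ _].
  by rewrite /lo k0 eqxx; apply: le_trans; rewrite le_max lexx.
have ballK y : ball x0 (r / 2) y -> positive_space y -> K y.
  move=> [_ yb] yp k; have := yb ord0 k; rewrite /ball/= ltr_distlC => /andP[l u].
  rewrite in_itv/= (ltW u) andbT /lo; case: ifPn => [/eqP k0|_]; last exact: ltW.
  by rewrite ge_max !ltW//= yp.
exists (chart i @^-1` ball x0 (r / 2)).
  by apply: near_chart => //; exact: nbhsx_ballx.
move=> e e0; have := ba i [::] K cK Kim e e0 => /=.
apply: filterS2 cb => s cbs bs q qN iq.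
have nq : nbhs (chart i q) (ball x0 (r / 2)).
  apply: open_nbhs_nbhs; split=> //; exact: ball_open.
have [Qq hq] : (Q `&` half_space R m) (chart i q) by rewrite -imE; exists q.
have nQq : nbhs (chart i q) Q by exact: open_nbhs_nbhs.
pose d := b s - a.
have cd : cont_section d by exact: cont_fieldB.
have lim : `|d i (cochart i (chart i q + y *: inward m))| @[y --> 0^'+] --> `|d i q|.
  apply: cvg_norm; apply: (@cvg_comp _ _ _ _ (d i) _ (nbhs q)); last exact: cd.
  move=> W qW.
  have := near_inward hq (@filterI _ (nbhs (chart i q)) (nbhs_filter _) _ _
    nQq (near_cochart iq qW)).
  apply: filterS => y [[yQ yW] /positive_half_space yh]; apply: yW.
  by rewrite imE.
apply: (cvgr_to_le lim).
have := near_inward hq (@filterI _ (nbhs (chart i q)) (nbhs_filter _) _ _ nQq nq).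
apply: filterS => y [[yQ yb] yp]; apply: bs; first exact: ballK.
have nQy : nbhs (chart i q + y *: inward m) Q by exact: open_nbhs_nbhs.
have npy : nbhs (chart i q + y *: inward m) (@positive_space R m).
  by apply: open_nbhs_nbhs; split=> //; exact: open_positive.
have := @filterI _ (nbhs (chart i q + y *: inward m)) (nbhs_filter _) _ _ nQy npy.
apply: filterS => z [zQ /positive_half_space zh].
by rewrite imE.
Qed.

Section velocity.
Variables (I : set R) (c v : R -> field).
Hypotheses (cc : forall t, I t -> cont_section (c t)) (cv : is_velocity I c v).

Lemma velocity_locally_uniform t i p : I t -> dom i p ->
  exists2 N : set M, nbhs p N & forall e : R, 0 < e ->
    \forall s \near nbhs t, I s -> s != t -> forall q, N q -> dom i q ->
      `|(s - t)^-1 *: (c s i q - c t i q) - v t i q| <= e.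
Proof.
move=> It ip; have [vt cvt] := cv It.
have [|N pN Ne] := frechet_cvg_locally_uniform _ (Omega1_cont vt) cvt ip.
  rewrite near_withinE; apply: filterE => s [Is _].
  exact: cont_fieldZ (cont_fieldB (cc Is) (cc It)).
exists N => // e e0; have := Ne e e0; rewrite near_withinE; apply: filterS.
by move=> s h Is st; apply: h; split=> //; apply/eqP.
Qed.

Lemma velocity_pointwise t i p : I t -> dom i p -> forall e : R, 0 < e ->
  \forall s \near t, I s -> s != t ->
    `|(s - t)^-1 *: (c s i p - c t i p) - v t i p| <= e.
Proof.
move=> It ip e e0; have [N pN Ne] := velocity_locally_uniform It ip.
apply: filterS (Ne e e0) => s h Is st; apply: h => //.
exact: nbhs_singleton.
Qed.

(** The difference quotients are bounded uniformly around [p], so that [c s] is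
    close to [c t] there; continuity of [c t] does the rest. *)
Lemma velocity_joint_continuity t i p : I t -> dom i p -> forall e : R, 0 < e ->
  \forall z \near (t, p), I z.1 -> `|c z.1 i z.2 - c t i p| < e.
Proof.
move=> It ip e e0; have [N pN Ne] := velocity_locally_uniform It ip.
have [vt _] := cv It.
set B := `|v t i p| + 2.
have B0 : 0 < B by rewrite ltr_wpDl.
have hv : \forall q \near p, `|v t i q| < `|v t i p| + 1.
  by apply: (cvgr_lt _ (cvg_norm (Omega1_cont vt ip))); rewrite ltrDl.
have hc : \forall q \near p, `|c t i p - c t i q| < e / 2.
  by have /cvgrPdist_lt := cc It ip; apply; rewrite divr_gt0.
have hd : nbhs p (dom i) by apply: open_nbhs_nbhs; split=> //; exact: dom_open.
have hs : \forall s \near t, `|t - s| < e / 2 / B.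
  by apply: nbhsx_ballx; rewrite !divr_gt0.
have h1 := Ne 1 ltr01.
near=> z => Iz.
have z2 : `|c t i p - c t i z.2| < e / 2 by near: z; apply: cvg_snd hc.
have [->|zt] := eqVneq z.1 t.
  by rewrite distrC (lt_trans z2)// ltr_pdivrMr// ltr_pMr// ltr1n.
have q1 : `|(z.1 - t)^-1 *: (c z.1 i z.2 - c t i z.2) - v t i z.2| <= 1.
  apply: (_ : forall q, N q -> dom i q -> `|(z.1 - t)^-1 *: (c z.1 i q - c t i q) - v t i q| <= 1).
  - have : I z.1 -> z.1 != t -> forall q, N q -> dom i q ->
      `|(z.1 - t)^-1 *: (c z.1 i q - c t i q) - v t i q| <= 1.
      by near: z; apply: cvg_fst h1.
    exact.
  - by near: z; apply: cvg_snd pN.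
  - by near: z; apply: cvg_snd hd.
have q2 : `|v t i z.2| < `|v t i p| + 1 by near: z; apply: cvg_snd hv.
have zs : `|t - z.1| < e / 2 / B by near: z; apply: cvg_fst hs.
have zt0 : z.1 - t != 0 by rewrite subr_eq0.
have q3 : `|c z.1 i z.2 - c t i z.2| < e / 2.
  rewrite -[X in `|X|](scalerKV zt0) normrZ distrC.
  apply: (@le_lt_trans _ _ (`|t - z.1| * B)); last by rewrite -ltr_pdivlMr.
  rewrite ler_wpM2l// -[X in `|X|](subrK (v t i z.2)).
  rewrite (le_trans (ler_normD _ _))// /B [leRHS](_ : _ = 1 + (`|v t i p| + 1)).
    by rewrite lerD// ltW.
  by rewrite addrCA.
rewrite (splitr e) -(subrK (c t i z.2) (c z.1 i z.2)) -addrA.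
by rewrite (le_lt_trans (ler_normD _ _))// ltrD// distrC.
Unshelve. all: by end_near. Qed.

End velocity.
End frechet.

(** * Differentiable paths of fields and their volume *)

Section paths.
Context {R : realType} {m n : nat} (M : manifold R m).

Local Notation field := (local_field M n).
Local Notation cont_section := (cont_on (@dom R m M)).
Local Notation cont_family := (cont_family_on (@dom R m M)).

(** The retraction onto [[a, b]]. Precomposing with it extends a curve on a segment
    to all times, which makes one-sided continuity at the end points two-sided. *)
Definition clamp (a b s : R) : R := Num.max a (Num.min b s).

Lemma clamp_id a b s : s \in `[a, b] -> clamp a b s = s.
Proof. by rewrite in_itv/= /clamp => /andP[sa sb]; rewrite min_r// max_r. Qed.

Lemma clamp_itv a b s : a <= b -> clamp a b s \in `[a, b].
Proof.
by move=> ab; rewrite in_itv/= /clamp le_max lexx/= ge_max ab/= ge_min lexx.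
Qed.

Lemma clamp_continuous a b : continuous (clamp a b).
Proof.
move=> s; apply/cvgrPdist_lt => e e0.
have : \forall t \near s, `|s - t| < e by apply: nbhsx_ballx.
apply: filterS => t; apply: le_lt_trans.
have h1 := ler_norm (s - t); have h2 := ler_norm (t - s).
rewrite (distrC t) in h2; rewrite ler_norml /clamp; apply/andP.
case: (lerP b s) => bs; case: (lerP b t) => bt; do 2?case: (lerP a _) => ?;
  split; lra.
Qed.

Lemma is_velocity_congr (I : set R) (c c' v v' : R -> field) :
  (forall t, I t -> c t = c' t) -> (forall t, I t -> v t = v' t) ->
  is_velocity I c v -> is_velocity I c' v'.
Proof.
move=> cc' vv' cv t It; rewrite -vv'//; have [vt cvt] := cv t It; split=> //.
move=> i w K cK Ki e e0; have := cvt i w K cK Ki e e0.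
rewrite !near_simpl !near_withinE; apply: filterS => s /[swap] Its /(_ Its).
by rewrite -!cc'//; case: Its.
Qed.

Lemma itv_punctured_near (a b t : R) (P : set R) : a < b -> t \in `[a, b] ->
  (\forall s \near t, s \in `[a, b] -> s != t -> P s) ->
  exists s, [/\ s \in `[a, b], s != t & P s].
Proof.
move=> ab; rewrite in_itv/= => /andP[ta tb] /nbhs_ballP[e /= e0 eP].
have [tb'|tb'] := ltP t b.
  pose s := Num.min b (t + e / 2).
  have st : t < s by rewrite lt_min tb' ltrDl divr_gt0.
  have sb : s <= b by rewrite ge_min lexx.
  have se : s <= t + e / 2 by rewrite ge_min lexx orbT.
  have s_ab : s \in `[a, b] by rewrite in_itv/= sb andbT (le_trans ta)// ltW.
  have st' : s != t by rewrite gt_eqF.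
  exists s; split=> //; apply: eP => //; rewrite /ball/= ltr0_norm; lra.
pose s := Num.max a (t - e / 2).
have st : s < t by rewrite gt_max (lt_le_trans ab tb')/= ltrBlDr ltrDl divr_gt0.
have sa : a <= s by rewrite le_max lexx.
have se : t - e / 2 <= s by rewrite le_max lexx orbT.
have s_ab : s \in `[a, b] by rewrite in_itv/= sa (le_trans _ tb)// ltW.
have st' : s != t by rewrite lt_eqF.
exists s; split=> //; apply: eP => //; rewrite /ball/= gtr0_norm; lra.
Qed.

(** A velocity is a pointwise limit of difference quotients, and fields are
    normalised to [0] outside of the charts, so it is unique as a field. *)
Lemma velocity_unique (a b : R) (c v v' : R -> field) : a < b ->
  (forall t, t \in `[a, b] -> cont_section (c t)) ->
  is_velocity `[a, b] c v -> is_velocity `[a, b] c v' ->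
  forall t, t \in `[a, b] -> v t = v' t.
Proof.
move=> ab cc cv cv' t It; apply/funext => i; apply/funext => p.
have [[v0 _ _] _] := cv t It; have [[v'0 _ _] _] := cv' t It.
have [ip|nip] := pselect (dom i p); last by rewrite v0// v'0.
apply/eqP; rewrite -subr_eq0 -normr_le0; apply/ler_addgt0Pl => e e0.
rewrite addr0.
have e20 : 0 < e / 2 by rewrite divr_gt0.
have h := velocity_pointwise cc cv It ip e20.
have h' := velocity_pointwise cc cv' It ip e20.
have [|s [Is st [hs hs']]] := @itv_punctured_near a b t (fun s =>
    `|(s - t)^-1 *: (c s i p - c t i p) - v t i p| <= e / 2 /\
    `|(s - t)^-1 *: (c s i p - c t i p) - v' t i p| <= e / 2) ab It.
  by apply: filterS2 h h' => s hs hs' Is st; split; [exact: hs|exact: hs'].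
rewrite (splitr e).
set q := (s - t)^-1 *: _ in hs hs'.
have -> : v t i p - v' t i p = (q - v' t i p) - (q - v t i p).
  by rewrite opprB [RHS]addrC addrA subrK.
by rewrite (le_trans (ler_normB _ _))// lerD.
Qed.

(** What differentiation under the integral needs of a velocity in the Frechet
    sense: derivatives at each point, and continuity in time and space jointly. *)
Definition C1_path (a b : R) (A V : R -> field) : Prop :=
  [/\ cont_family [set: R] A, cont_family [set: R] V &
      forall t (i : idx M) p, t \in `]a, b[ -> dom i p -> forall j k,
        is_derive t (1 : R) (fun s => A s i p j k) (V t i p j k)].

Lemma velocity_cont_family a b (c v : R -> field) : a < b ->
  (forall t, t \in `[a, b] -> cont_section (c t)) ->
  is_velocity `[a, b] c v -> cont_family [set: R] (c \o clamp a b).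
Proof.
move=> ab cc cv t i p _ ip; apply/cvgrPdist_lt => e e0.
have It : clamp a b t \in `[a, b] by exact/clamp_itv/ltW.
have := velocity_joint_continuity cc cv It ip e0.
have hc : (clamp a b z.1, z.2) @[z --> (t, p)] --> (clamp a b t, p).
  have c1 : clamp a b z.1 @[z --> (t, p)] --> clamp a b t.
    apply: (@cvg_comp _ _ _ fst (clamp a b)); first exact: cvg_fst.
    exact: clamp_continuous.
  exact: (cvg_pair c1 cvg_snd).
move=> h0; have h1 : \forall z \near (t, p), clamp a b z.1 \in `[a, b] ->
    `|c (clamp a b z.1) i z.2 - c (clamp a b t) i p| < e := hc _ h0.
near=> z; rewrite distrC; apply: (near h1 z) => //.
exact/clamp_itv/ltW.
Unshelve. all: by end_near. Qed.

Lemma velocity_is_derive a b (c v : R -> field) : a < b ->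
  (forall t, t \in `[a, b] -> cont_section (c t)) ->
  is_velocity `[a, b] c v ->
  forall t (i : idx M) p, t \in `]a, b[ -> dom i p -> forall j k,
    is_derive t (1 : R) (fun s => c (clamp a b s) i p j k)
      (v (clamp a b t) i p j k).
Proof.
move=> ab cc cv t i p tI ip j k.
have It : t \in `[a, b] by exact: subset_itv_oo_cc tI.
have nI : \forall s \near t, s \in `[a, b].
  have := near_in_itvoo tI.
  by apply: filterS => s; exact: subset_itv_oo_cc.
have cvg_q : (s - t)^-1 *: (c s i p - c t i p) @[s --> t^'] --> v t i p.
  apply/cvgrPdist_le => e e0; have := velocity_pointwise cc cv It ip e0.
  rewrite near_withinE; apply: filterS2 nI => s Is h st.
  by rewrite distrC; exact: h.
rewrite clamp_id//.
have := (iffLR (mx_cvgP _ _) cvg_q) j k => cvg_jk.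
have ceq : \forall s \near t, c s i p j k = c (clamp a b s) i p j k.
  by apply: filterS nI => s Is; rewrite clamp_id.
apply: (@near_eq_is_derive R R R (fun s => c s i p j k)
  (fun s => c (clamp a b s) i p j k) t 1 _ ceq).
have cvg_h : h^-1 *: (c (h *: 1 + t) i p j k - c t i p j k) @[h --> 0^'] -->
    v t i p j k.
  have sh : (h *: 1 + t) @[h --> 0^'] --> t^'.
    move=> P; rewrite /dnbhs /within/= => tP.
    have c0 : (h *: 1 + t) @[h --> (0 : R)] --> t.
      rewrite -[X in _ --> X](add0r t) -[X in _ --> X + t](scale0r (1 : R)).
      by apply: cvgD; [apply: cvgZr_tmp; exact: cvg_id|exact: cvg_cst].
    suff : \forall h \near (0 : R), h != 0 -> P (h *: 1 + t) by [].
    have h1 : \forall h \near (0 : R), h *: 1 + t != t -> P (h *: 1 + t) := c0 _ tP.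
    apply: filterS h1 => h hP h0; apply: hP.
    by rewrite -subr_eq0 addrK scaler_eq0 negb_or h0 oner_neq0.
  pose g x := ((x - t)^-1 *: (c x i p - c t i p)) j k.
  have -> : (fun h : R => h^-1 *: (c (h *: 1 + t) i p j k - c t i p j k)) =
      g \o (fun h : R => h *: 1 + t).
    by apply/funext => h; rewrite /g /= !mxE addrK [h *: 1]mulr1.
  exact: (cvg_comp _ _ sh (cvg_jk _)).
apply: DeriveDef; first by apply/cvg_ex; exists (v t i p j k).
exact: cvg_lim.
Qed.

Lemma smooth_curve_C1_path a b (c v : R -> field) : a < b ->
  smooth_curve `[a, b] c -> is_velocity `[a, b] c v ->
  C1_path a b (c \o clamp a b) (v \o clamp a b).
Proof.
move=> ab [Oc [D [D0 DS]]] cv.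
have cc t : t \in `[a, b] -> cont_section (c t).
  by move=> It; apply: Omega1_cont; exact: Oc.
have cD1 : is_velocity `[a, b] c (D 1%N).
  by apply: (is_velocity_congr _ _ (DS 0%N)).
have vD1 := velocity_unique ab cc cv cD1.
have cvel t : t \in `[a, b] -> cont_section (v t).
  by move=> It; apply: Omega1_cont; have [] := cv t It.
have vel2 : is_velocity `[a, b] v (D 2%N).
  by apply: (is_velocity_congr _ _ (DS 1%N)) => // t It; rewrite vD1.
split.
- exact: velocity_cont_family cv.
- exact: velocity_cont_family vel2.
- exact: velocity_is_derive cv.
Qed.

Lemma C1_pathD a b (A V H K : R -> field) (r : R) :
  C1_path a b A V -> C1_path a b H K ->
  C1_path a b (A + r *: H) (V + r *: K).
Proof.
move=> [cA cV dA] [cH cK dH]; split.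
- move=> t i p tT ip; exact: cvgD (cA t i p tT ip) (cvgZ (cvg_cst r) (cH t i p tT ip)).
- move=> t i p tT ip; exact: cvgD (cV t i p tT ip) (cvgZ (cvg_cst r) (cK t i p tT ip)).
- move=> t i p tI ip j k.
  rewrite [X in is_derive _ _ _ X](_ : _ = V t i p j k + r * K t i p j k); last first.
    by rewrite !mxE.
  rewrite [X in is_derive _ _ X](_ : _ =
      (fun s => A s i p j k) + r *: (fun s => H s i p j k)); last first.
    by apply/funext => s; rewrite !mxE.
  have := dA t i p tI ip j k; have := dH t i p tI ip j k => ? ?.
  exact: is_deriveD.
Qed.

Lemma cont_family_vol D (T : topologicalType) (K : set T) (A : T -> field) :
  cont_family_on D K A -> cont_family_on D K (fun t i p => vol (A t i p)).
Proof. by move=> cA t i p Kt ip; exact: cvg_vol (cA t i p Kt ip). Qed.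

Lemma cont_family_fiber_density D (T : topologicalType) (K : set T)
    (A V W : T -> field) :
  (forall t i p, K t -> D i p -> 0 < \det (gram (A t i p))) ->
  cont_family_on D K A -> cont_family_on D K V -> cont_family_on D K W ->
  cont_family_on D K (fun t i p => fiber_density (A t i p) (V t i p) (W t i p)).
Proof.
move=> A0 cA cV cW t i p Kt ip.
apply: (cvg_fiber_density _ (cA t i p Kt ip) (cV t i p Kt ip) (cW t i p Kt ip)).
by rewrite gt_eqF// A0.
Qed.

Hypothesis cptM : compact [set: M].
Variable c : adapted_cover M.

Local Notation J := (density_integral_along c).

Section volume.
Variables (a b : R) (A V : R -> field).
Hypothesis (pA : C1_path a b A V).
Hypothesis A0 : forall t i p, covered c i p -> 0 < \det (gram (A t i p)).

Definition volume t := J (fun i p => vol (A t i p)).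
Definition volume' t := J (fun i p => fiber_density (A t i p) (V t i p) (A t i p)).

Lemma cont_family_volume :
  cont_family_on (covered c) [set: R] (fun t i p => vol (A t i p)).
Proof.
have [cA _ _] := pA; apply: cont_family_vol.
exact: (cont_family_on_sub (@covered_dom _ _ _ c) cA).
Qed.

Lemma volume_continuous : continuous volume.
Proof. by apply: continuous_density_integral => //; exact: cont_family_volume. Qed.

Lemma cont_family_volume' : cont_family_on (covered c) [set: R]
  (fun t i p => fiber_density (A t i p) (V t i p) (A t i p)).
Proof.
have [cA cV _] := pA; have sub := @covered_dom _ _ _ c.
apply: cont_family_fiber_density; first by move=> t i p _; exact: A0.
- exact: (cont_family_on_sub sub cA).
- exact: (cont_family_on_sub sub cV).
- exact: (cont_family_on_sub sub cA).
Qed.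

Lemma volume'_continuous : continuous volume'.
Proof. by apply: continuous_density_integral => //; exact: cont_family_volume'. Qed.

Lemma is_derive_volume t : t \in `]a, b[ -> is_derive t (1 : R) volume (volume' t).
Proof.
move=> tI; have [cA cV dA] := pA.
have [C C0 FC] := cont_family_bounded cptM (@segment_compact _ a b)
  (fun s i p _ => @cont_family_volume' s i p Logic.I).
apply: (@is_derive_density_integral _ _ _ cptM c _
  (fun s i p => fiber_density (A s i p) (V s i p) (A s i p)) a b t C tI (ltW C0)).
- by move=> s _; exact: (cont_family_on_at cont_family_volume).
- move=> s i p sI ip; apply: is_derive_vol; first exact: A0.
  by apply: dA => //; exact: covered_dom ip.
- move=> s k p sI kp; apply: FC; first exact: subset_itv_oo_cc sI.
  exact: subset_closure.
Qed.

End volume.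
End paths.

(** * Multiples of a fixed one-form *)

Section smooth_scaling.
Context {R : realType} {m : nat} {V : normedModType R}.
Implicit Types f g : 'rV[R]_m -> V.

Lemma pd_eq_on (W : set 'rV[R]_m) f g (w : seq 'I_m) : open W ->
  (forall y, W y -> f y = g y) -> forall y, W y -> pd w f y = pd w g y.
Proof.
move=> oW fg; elim: w => [|k w IH] y Wy /=; first exact: fg.
apply: near_eq_derive.
have : nbhs y W by exact: open_nbhs_nbhs.
by apply: filterS => z Wz; exact: IH.
Qed.

Lemma pdZ (W : set 'rV[R]_m) g (w : seq 'I_m) (k : R) : open W ->
  smooth_open W g -> forall y, W y -> pd w (k *: g) y = k *: pd w g y.
Proof.
move=> oW sg; elim: w => [|j w IH] y Wy //=.
have [_ /(_ j) dg] := sg w y Wy.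
rewrite -[RHS]/(k *: 'D_(delta_mx ord0 j) (pd w g) y) -deriveZ//.
apply: near_eq_derive.
have : nbhs y W by exact: open_nbhs_nbhs.
by apply: filterS => z Wz; exact: IH.
Qed.

Lemma smooth_openZ (W : set 'rV[R]_m) g (k : R) : open W ->
  smooth_open W g -> smooth_open W (k *: g).
Proof.
move=> oW sg w y Wy; have [cg dg] := sg w y Wy.
have nW : \forall z \near y, (k *: pd w g) z = pd w (k *: g) z.
  have : nbhs y W by exact: open_nbhs_nbhs.
  by apply: filterS => z Wz; rewrite (pdZ w k oW sg Wz).
split.
  rewrite /prop_for /continuous_at -(nbhs_singleton nW).
  have h : (k *: pd w g) z @[z --> y] --> (k *: pd w g) y.
    exact: cvgZ (cvg_cst k) cg.
  exact: (cvg_trans (near_eq_cvg nW) h).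
move=> j; apply: (near_eq_derivable nW).
exact: derivableZ.
Qed.

Lemma smooth_onZ (A : set 'rV[R]_m) f (k : R) :
  smooth_on A f -> smooth_on A (k *: f).
Proof.
move=> sf x Ax; have [W [g [oW Wx sg fg]]] := sf x Ax.
exists W, (k *: g); split=> //; first exact: smooth_openZ.
by move=> y Wy Ay; rewrite !fctE fg.
Qed.

(** At interior points the partial derivatives are those of a local smooth
    extension. *)
Lemma smooth_on_interior (A : set 'rV[R]_m) f x : smooth_on A f -> A x ->
  exists W g, [/\ open W, W x, smooth_open W g &
    forall w k y, W y -> A° y ->
      pd w f y = pd w g y /\ pd w (k *: f) y = k *: pd w g y].
Proof.
move=> sf Ax; have [W [g [oW Wx sg fg]]] := sf x Ax.
exists W, g; split=> // w k y Wy Ay.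
have oWA : open (W `&` A°) by apply: openI => //; exact: open_interior.
have fgE z : (W `&` A°) z -> f z = g z.
  by move=> [Wz /interior_subset Az]; exact: fg.
split; first exact: (pd_eq_on w oWA fgE).
rewrite -(pdZ w k oW sg Wy); apply: (pd_eq_on w oWA) => // z zWA.
by rewrite !fctE fgE.
Qed.

(** The partial derivatives extend continuously to the boundary, hence are
    bounded near it. *)
Lemma pd_bounded (A K : set 'rV[R]_m) f (w : seq 'I_m) : smooth_on A f ->
  compact K -> K `<=` A ->
  exists C : R, forall x, K x -> A° x -> `|pd w f x| <= C.
Proof.
move=> sf /compact_near_coveringP cK KA.
have ne : \forall C \near +oo, K `<=` (fun y => A° y -> `|pd w f y| <= C).
  apply: (cK R (pinfty_nbhs R) (fun C y => A° y -> `|pd w f y| <= C)).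
  move=> x Kx; have [W [g [oW Wx sg fg]]] := smooth_on_interior sf (KA x Kx).
  have [cg _] := sg w x Wx.
  have hg : \forall y \near x, `|pd w g y| < `|pd w g x| + 1.
    by apply: (cvgr_lt _ (cvg_norm cg)); rewrite ltrDl.
  have nW : nbhs x W by exact: open_nbhs_nbhs.
  exists ([set y | `|pd w g y| < `|pd w g x| + 1] `&` W,
          [set C | `|pd w g x| + 1 <= C]).
    by split; [exact: filterI hg nW|exact: nbhs_pinfty_ge].
  move=> [y C] /= [[hy Wy] hC] Ay; have [-> _] := fg w 1 y Wy Ay.
  by rewrite (le_trans (ltW hy)).
have [C CP] := filter_ex ne.
by exists C => x Kx Ax; exact: CP.
Qed.

End smooth_scaling.

Section scaling_curves.
Context {R : realType} {m n : nat} (M : manifold R m).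
Local Notation field := (local_field M n).
Variable al : field.
Hypothesis Oal : Omega1 M n al.

Lemma Omega1Z (k : R) : Omega1 M n (k *: al).
Proof.
have [a0 sa ta] := Oal; split.
- by move=> i p nip; rewrite !fctE a0// scaler0.
- move=> i; have -> : (k *: al) i \o cochart i = k *: (al i \o cochart i) by [].
  exact: smooth_onZ.
- move=> i j p J ip jp h; rewrite !fctE.
  by rewrite (ta i j p J ip jp h) scalemxAl.
Qed.

Lemma frechet_cvgZ (T : Type) (F : set_system T) {FF : Filter F} (k : T -> R)
    (l : R) : k s @[s --> F] --> l ->
  frechet_cvg ((fun s => k s *: al) @ F) (l *: al).
Proof.
move=> kl i w K cK Ki e e0.
have [_ sa _] := Oal.
have [C CP] := pd_bounded w (sa i) cK Ki.
have C0 : 0 < `|C| + 1 by rewrite ltr_wpDl.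
have : \forall s \near F, `|l - k s| < e / (`|C| + 1).
  by have /cvgrPdist_lt := kl; apply; rewrite divr_gt0.
apply: filterS => s ks x Kx Ax.
have -> : (k s *: al - l *: al) i \o cochart i = (k s - l) *: (al i \o cochart i).
  by apply/funext => y; rewrite !fctE -scalerBl.
have [W [g [oW Wx sg fg]]] := smooth_on_interior (sa i) (Ki x Kx).
have [fE ->] := fg w (k s - l) x Wx Ax.
rewrite -fE normrZ distrC.
apply: (@le_trans _ _ (`|l - k s| * (`|C| + 1))).
  by rewrite ler_wpM2l// (le_trans (CP x Kx Ax))// (le_trans (ler_norm _))// lerDl.
by rewrite -ler_pdivlMr// ltW.
Qed.

Lemma is_velocityZ (I : set R) (f f' : R -> R) :
  (forall t, I t -> is_derive t (1 : R) f (f' t)) ->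
  is_velocity I (fun t => f t *: al) (fun t => f' t *: al).
Proof.
move=> df t It; split; first exact: Omega1Z.
have -> : (fun s => (s - t)^-1 *: (f s *: al - f t *: al)) =
    (fun s => ((s - t)^-1 * (f s - f t)) *: al).
  by apply/funext => s; rewrite -scalerBl scalerA.
apply: frechet_cvgZ.
have [+ dfE] := df t It; move=> /cvg_ex[/= l hl].
have lE : l = f' t by rewrite -dfE; apply/esym/cvg_lim.
rewrite lE in hl.
have sh : (s - t) @[s --> within (I `\ t) (nbhs t)] --> (0 : R)^'.
  move=> P; rewrite /dnbhs /within/= => P0.
  have c0 : (s - t) @[s --> t] --> (0 : R).
    by rewrite -(subrr t); apply: cvgB; [exact: cvg_id|exact: cvg_cst].
  have h1 : \forall s \near t, s - t != 0 -> P (s - t) := c0 _ P0.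
  apply: filterS h1 => s hs [_ /= st]; apply: hs.
  by rewrite subr_eq0; apply/eqP.
have := cvg_comp _ _ sh hl.
rewrite (_ : _ \o _ = fun s => (s - t)^-1 * (f s - f t))//.
by apply/funext => s /=; rewrite [_ *: 1]mulr1 subrK.
Qed.

Lemma smooth_curveZ (I : set R) (f : nat -> R -> R) :
  (forall k t, I t -> is_derive t (1 : R) (f k) (f k.+1 t)) ->
  smooth_curve I (fun t => f 0%N t *: al).
Proof.
move=> df; split; first by move=> t _; exact: Omega1Z.
exists (fun k t => f k t *: al); split=> // k.
by apply: is_velocityZ => t It; exact: df.
Qed.

End scaling_curves.

Section power_path.
Context {R : realType}.
Implicit Types (x y q s : R) (k : nat).

(** The [k]-th derivative of [s |-> (x + y s) `^ q]. *)
Definition power_path (x y q : R) (k : nat) (s : R) : R :=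
  y ^+ k * \prod_(j < k) (q - j%:R) * (x + y * s) `^ (q - k%:R).

Lemma power_path0 x y q s : power_path x y q 0 s = (x + y * s) `^ q.
Proof. by rewrite /power_path big_ord0 expr0 !mul1r subr0. Qed.

Lemma power_path1 x y q s :
  power_path x y q 1 s = y * q * (x + y * s) `^ (q - 1).
Proof. by rewrite /power_path big_ord1 expr1 subr0. Qed.

Lemma is_derive_power_path x y q k s : 0 < x + y * s ->
  is_derive s (1 : R) (power_path x y q k) (power_path x y q k.+1 s).
Proof.
move=> p0.
have d1 : is_derive s (1 : R) (fun s => x + y * s) y.
  apply: is_derive_eq; rewrite scaler1 add0r//; ring.
have d2 := @is_derive1_comp _ (fun u : R => u `^ (q - k%:R)) _ s _ _
  (is_derive1_powR (q - k%:R) p0) d1.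
have d3 := @is_deriveZ R R R _ (y ^+ k * \prod_(j < k) (q - j%:R)) s 1 _ d2.
apply: (is_derive_eq d3).
rewrite /power_path exprS big_ord_recr/= -(natr1 k) opprD addrA /GRing.scale/=.
ring.
Qed.

End power_path.

(** * Radial decomposition of the energy and lower bound of the length *)

Section energy_identity.
Context {R : realType} {m n : nat} (M : manifold R m).
Hypothesis cptM : compact [set: M].
Variable c : adapted_cover M.
Local Notation field := (local_field M n).
Local Notation J := (density_integral_along c).

Lemma cont_on_fiber_density D (A V W : field) :
  (forall i p, D i p -> 0 < \det (gram (A i p))) ->
  cont_on D A -> cont_on D V -> cont_on D W ->
  cont_on D (fun i p => fiber_density (A i p) (V i p) (W i p)).
Proof.
move=> A0 cA cV cW i p ip.
apply: (cvg_fiber_density _ (cA i p ip) (cV i p ip) (cW i p ip)).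
by rewrite gt_eqF// A0.
Qed.

Lemma cont_on_vol D (A : field) :
  cont_on D A -> cont_on D (fun i p => vol (A i p)).
Proof. by move=> cA i p ip; exact: cvg_vol (cA i p ip). Qed.

Variables A V : field.
Hypotheses (cA : cont_on (covered c) A) (cV : cont_on (covered c) V).
Hypothesis A0 : forall i p, covered c i p -> 0 < \det (gram (A i p)).

(** The integral of the pointwise completion of the square. With [W] the volume
    along a path and [V] the velocity, it reads
    [G(V, V) = 2 mu W' - mu^2 m W + G(V - mu A, V - mu A)]. *)
Lemma energy_radial (mu : R) :
  J (fun i p => fiber_density (A i p) (V i p) (V i p)) =
  2 * mu * J (fun i p => fiber_density (A i p) (V i p) (A i p)) -
  mu ^+ 2 * m%:R * J (fun i p => vol (A i p)) +
  J (fun i p => fiber_density (A i p) (V i p - mu *: A i p) (V i p - mu *: A i p)).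
Proof.
have cW : cont_on (covered c) (V - mu *: A).
  by move=> i p ip; exact: cvgB (cV ip) (cvgZ (cvg_cst mu) (cA ip)).
have c1 := cont_on_fiber_density A0 cA cV cA.
have c2 := cont_on_vol cA.
have c3 := cont_on_fiber_density A0 cA cW cW.
rewrite -mulNr -!density_integralZ// -!density_integralD//.
- apply: eq_density_integral => i p ip.
  rewrite (fiber_density_radial (V i p) mu); last by rewrite gt_eqF// A0.
  by rewrite mulNr.
- by apply: cont_onD; exact: cont_onZ.
- exact: cont_onZ.
- exact: cont_onZ.
Qed.

(** The Cauchy-Schwarz inequality for the pairing with [A], whose square norm is
    [m W]: drop the last square in [energy_radial] for the optimal [mu]. *)
Lemma sqr_volume'_le : 0 < J (fun i p => vol (A i p)) -> (0 < m)%N ->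
  J (fun i p => fiber_density (A i p) (V i p) (A i p)) ^+ 2 <=
  m%:R * J (fun i p => vol (A i p)) *
  J (fun i p => fiber_density (A i p) (V i p) (V i p)).
Proof.
move=> W0 m0; set W := J _ in W0 *; set W' := J _; set G := J _.
have mR : 0 < m%:R :> R by rewrite ltr0n.
have mW : 0 < m%:R * W by rewrite mulr_gt0.
have := energy_radial (W' / (m%:R * W)); rewrite -/W -/W' -/G => GE.
have : 0 <= G - (2 * (W' / (m%:R * W)) * W' - (W' / (m%:R * W)) ^+ 2 * m%:R * W).
  rewrite {1}GE addrC addKr; apply: density_integral_ge0 => i p ip.
  rewrite mulr_ge0 ?sqrtr_ge0// fiber_form_ge0// gt_eqF// A0//.
have -> : 2 * (W' / (m%:R * W)) * W' - (W' / (m%:R * W)) ^+ 2 * m%:R * W =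
    W' ^+ 2 / (m%:R * W) by field; rewrite !gt_eqF.
by rewrite subr_ge0 ler_pdivrMr// mulrC.
Qed.

End energy_identity.

Section quadratic.
Context {R : realType}.

(** This replaces the computation of a first variation: it suffices to bound the
    energy by a quadratic error. *)
Lemma is_derive_quadratic (E : R -> R) (C : R) :
  (\forall r \near (0 : R), `|E r - E 0| <= C * r ^+ 2) ->
  is_derive (0 : R) (1 : R) E 0.
Proof.
move=> EC.
have lim : h^-1 *: (E (h *: 1 + 0) - E 0) @[h --> 0^'] --> (0 : R).
  apply/cvgrPdist_le => e e0.
  have hC : 0 < e / (`|C| + 1) by rewrite divr_gt0// ltr_wpDl.
  have h0 : \forall r \near (0 : R), `|0 - r| < e / (`|C| + 1) by exact: nbhsx_ballx.
  rewrite near_withinE; apply: filterS2 EC h0 => h hE; rewrite sub0r normrN => he hn0.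
  rewrite sub0r normrN normrZ [h *: 1]mulr1 addr0 normfV.
  rewrite ler_pdivrMl ?normr_gt0// (le_trans hE)//.
  rewrite -real_normK ?num_real// expr2 mulrA mulrC ler_wpM2l//.
  apply: (@le_trans _ _ ((`|C| + 1) * `|h|)).
    by rewrite ler_wpM2r// (le_trans (ler_norm _))// lerDl.
  by rewrite -ler_pdivlMl// mulrC ltW.
apply: DeriveDef; first by apply/cvg_ex; exists 0.
exact: cvg_lim.
Qed.

Lemma continuous_integrable_segment (f : R -> R) (a b : R) : continuous f ->
  (@lebesgue_measure R).-integrable `[a, b] (EFin \o f).
Proof.
move=> cf; apply: continuous_compact_integrable; first exact: segment_compact.
exact: continuous_subspaceT.
Qed.

Lemma FTC_continuous (F f : R -> R) (a b : R) : a < b -> continuous F ->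
  continuous f -> (forall t, t \in `]a, b[ -> is_derive t (1 : R) F (f t)) ->
  (\int[lebesgue_measure]_(t in `[a, b]) (f t)%:E = (F b - F a)%:E)%E.
Proof.
move=> ab cF cf dF; rewrite EFinB; apply: continuous_FTC2 => //.
- exact: continuous_subspaceT.
- split.
  + by move=> t tI; have [] := dF t tI.
  + by apply: cvg_at_right_filter; exact: cF.
  + by apply: cvg_at_left_filter; exact: cF.
- by move=> t tI; rewrite derive1E; have ? := dF t tI; rewrite derive_val.
Qed.

End quadratic.

Section metric.
Context {R : realType} {m n : nat} (M : manifold R m).
Hypothesis cptM : compact [set: M].
Hypothesis M0 : [set: M] !=set0.
Hypothesis m0 : (0 < m)%N.
Local Notation field := (local_field M n).

Lemma density_integral_cover : exists c : adapted_cover M,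
  forall f, density_integral f = density_integral_along c f.
Proof.
exists (projT1 (cid (adapted_cover_exists cptM))) => f.
rewrite /density_integral; case: pselect => [h|/(_ (adapted_cover_exists cptM))//].
by rewrite (Prop_irrelevance h (adapted_cover_exists cptM)).
Qed.

Lemma Omega1_plus_gt0 (a : field) : Omega1_plus M n a ->
  forall (i : idx M) p, dom i p -> 0 < \det (gram (a i p)).
Proof. by move=> [_ inja] i p ip; apply: gram_det_gt0; exact: inja. Qed.

Variable c0 : adapted_cover M.
Hypothesis c0E : forall f, density_integral f = density_integral_along c0 f.
Local Notation J := (density_integral_along c0).

Definition total_volume (a : field) : R := J (fun i p => vol (a i p)).

Lemma total_volume_gt0 a : Omega1_plus M n a -> 0 < total_volume a.
Proof.
move=> pa; apply: density_integral_gt0 => //.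
  apply: cont_on_vol; apply: cont_on_sub (Omega1_cont pa.1).
  exact: covered_dom.
move=> i p ip; apply: vol_gt0; apply: Omega1_plus_gt0 => //.
exact: covered_dom ip.
Qed.

Lemma total_volumeZ (k : R) a : 0 <= k -> Omega1_plus M n a ->
  total_volume (k *: a) = k ^+ m * total_volume a.
Proof.
move=> k0 pa; rewrite /total_volume -density_integralZ//.
  by apply: eq_density_integral => i p _; rewrite volZ.
apply: cont_on_vol; apply: cont_on_sub (Omega1_cont pa.1).
exact: covered_dom.
Qed.

Lemma Omega1_plusZ (k : R) a : k != 0 -> Omega1_plus M n a ->
  Omega1_plus M n (k *: a).
Proof.
move=> k0 [Oa inja]; split; first exact: Omega1Z.
move=> i p ip u v /=; rewrite !fctE -!scalemxAl => /(congr1 ( *:%R k^-1)).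
by rewrite !scalerA mulVf// !scale1r; exact: inja.
Qed.

(** By [sqr_volume'_le], the derivative [W' / (2 sqrt W)] of the square root of the
    volume is at most [sqrt m / 2] times the speed. So the square root of the
    volume is Lipschitz for the geodesic distance. *)
Lemma curve_length_ge (c v : R -> field) :
  smooth_curve `[0, 1] c -> is_velocity `[0, 1] c v ->
  (forall t, t \in `[0, 1] -> Omega1_plus M n (c t)) ->
  ((Num.sqrt (total_volume (c 1)) - Num.sqrt (total_volume (c 0)))%:E <=
   (Num.sqrt m%:R / 2)%:E * curve_length c v)%E.
Proof.
move=> sc cv pc.
have pA := smooth_curve_C1_path ltr01 sc cv.
set A := c \o clamp 0 1 in pA; set V := v \o clamp 0 1 in pA.
have pAt t : Omega1_plus M n (A t) by apply: pc; exact/clamp_itv/ler01.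
have A0 t i p : covered c0 i p -> 0 < \det (gram (A t i p)).
  by move=> /covered_dom; exact: Omega1_plus_gt0.
have [cA cV _] := pA; have sub := @covered_dom _ _ _ c0.
have cA' t : cont_on (covered c0) (A t).
  exact: (cont_on_sub sub (cont_family_on_at (t := t) cA Logic.I)).
have cV' t : cont_on (covered c0) (V t).
  exact: (cont_on_sub sub (cont_family_on_at (t := t) cV Logic.I)).
pose W := volume c0 A; pose W' := volume' c0 A V.
have W0 t : 0 < W t by exact: total_volume_gt0.
pose G t := J (fun i p => fiber_density (A t i p) (V t i p) (V t i p)).
have G0 t : 0 <= G t.
  apply: density_integral_ge0 => i p ip.
  by rewrite mulr_ge0 ?sqrtr_ge0// fiber_form_ge0// gt_eqF// A0.
have cW : continuous W by exact: (volume_continuous cptM pA).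
have cW' : continuous W' by exact: (volume'_continuous cptM pA A0).
have cG : continuous G.
  apply: continuous_density_integral => //.
  apply: cont_family_fiber_density; first by move=> t i p _; exact: A0.
  - exact: (cont_family_on_sub sub cA).
  - exact: (cont_family_on_sub sub cV).
  - exact: (cont_family_on_sub sub cV).
pose S t := Num.sqrt (W t); pose S' t := (2 * Num.sqrt (W t))^-1 * W' t.
have cS : continuous S.
  by move=> t; apply: (continuous_cvg _ _ (cW t)); exact: sqrt_continuous.
have cS' : continuous S'.
  move=> t; apply: cvgM; last exact: cW'.
  apply: cvgV; first by rewrite mulf_neq0// gt_eqF// sqrtr_gt0.
  by apply: cvgM; [exact: cvg_cst|exact: cS].
have dS (t : R) : t \in `]0, 1[ -> is_derive t (1 : R) S (S' t).
  move=> tI; have dW := is_derive_volume cptM pA A0 tI.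
  exact: (@is_derive1_comp _ Num.sqrt _ _ _ _ (is_derive1_sqrt (W0 t)) dW).
have FTC := FTC_continuous ltr01 cS cS' dS.
pose K : R := Num.sqrt m%:R / 2.
have S'G t : S' t <= K * Num.sqrt (G t).
  have sW : 0 < Num.sqrt (W t) by rewrite sqrtr_gt0.
  have W'G : W' t <= Num.sqrt m%:R * Num.sqrt (W t) * Num.sqrt (G t).
    have mW0 : 0 <= m%:R * W t by rewrite mulr_ge0// ltW.
    rewrite -sqrtrM// -sqrtrM//; apply: le_trans (ler_norm _) _.
    rewrite -sqrtr_sqr ler_wsqrtr//.
    exact: (sqr_volume'_le cptM (cA' t) (cV' t) (@A0 t) (W0 t) m0).
  rewrite /S' mulrC ler_pdivrMr ?mulr_gt0//.
  rewrite (le_trans W'G)// /K le_eqVlt; apply/orP; left; apply/eqP.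
  by field.
have cKG : continuous (fun t => K * Num.sqrt (G t)).
  move=> t; apply: cvgM; first exact: cvg_cst.
  by apply: (continuous_cvg _ _ (cG t)); exact: sqrt_continuous.
have -> : (Num.sqrt (total_volume (c 1)) - Num.sqrt (total_volume (c 0)))%:E =
    (\int[lebesgue_measure]_(t in `[0%R, 1%R]) (S' t)%:E)%E.
  have A1 : A 1 = c 1 by rewrite /A /= clamp_id// in_itv/= lexx ler01.
  have A00 : A 0 = c 0 by rewrite /A /= clamp_id// in_itv/= lexx ler01.
  by rewrite FTC -A1 -A00.
have -> : ((Num.sqrt m%:R / 2)%:E * curve_length c v =
    \int[lebesgue_measure]_(t in `[0%R, 1%R]) (K * Num.sqrt (G t))%:E)%E.
  have -> : (curve_length c v =
      \int[lebesgue_measure]_(t in `[0%R, 1%R]) (Num.sqrt (G t))%:E)%E.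
    apply: eq_integral => t /set_mem/= tI; congr (Num.sqrt _)%:E.
    by rewrite /ebin_metric c0E /G /A /V /= clamp_id.
  have K0 : 0 <= K by rewrite divr_ge0 ?sqrtr_ge0.
  under [RHS]eq_integral do rewrite EFinM.
  rewrite [RHS]ge0_integralZl_EFin//.
  apply: (measurable_int lebesgue_measure); apply: continuous_integrable_segment.
  by move=> t; apply: (continuous_cvg _ _ (cG t)); exact: sqrt_continuous.
apply: le_integral => //.
- exact: continuous_integrable_segment.
- exact: continuous_integrable_segment.
- by move=> t _; rewrite lee_fin.
Qed.

End metric.

(** * Metric incompleteness *)

Section metric_incompleteness.
Context {R : realType} {m n : nat} (M : manifold R m).
Hypothesis cptM : compact [set: M].
Hypothesis M0 : [set: M] !=set0.
Hypothesis m0 : (0 < m)%N.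
Local Notation field := (local_field M n).
Variable al : field.
Hypothesis pal : Omega1_plus M n al.
Variable c0 : adapted_cover M.
Hypothesis c0E : forall f, density_integral f = density_integral_along c0 f.

(* the exponent for which the volume of [t `^ q *: al] is quadratic in [t] *)
Local Notation q := (2 / m%:R : R).

Lemma powR_2_div_m (u : R) : 0 <= u -> (u `^ q) ^+ m = u ^+ 2.
Proof.
move=> u0; rewrite -powR_mulrn ?powR_ge0// -powRrM -mulrA mulVf ?mulr1.
  by rewrite powR_mulrn.
by rewrite pnatr_eq0 -lt0n.
Qed.

Lemma power_path_velocity (x y s : R) : 0 < x + y * s ->
  power_path x y q 1 s = (y * q / (x + y * s)) * power_path x y q 0 s.
Proof.
move=> p0; rewrite power_path1 power_path0.
have -> : (x + y * s) `^ (q - 1) = (x + y * s) `^ q / (x + y * s).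
  by rewrite powRB ?powRr1 ?ltW// (gt_eqF p0) implybT.
by ring.
Qed.

Lemma fiber_density_diag (A : 'M[R]_(n, m)) (mu : R) : 0 < \det (gram A) ->
  fiber_density A (mu *: A) (mu *: A) = mu ^+ 2 * m%:R * vol A.
Proof.
move=> A0; rewrite /fiber_density fiber_formZl fiber_formZr fiber_form_diag ?gt_eqF//.
by rewrite expr2 !mulrA.
Qed.

Lemma power_path_plus (x y s : R) : 0 < x + y * s ->
  Omega1_plus M n (power_path x y q 0 s *: al).
Proof.
by move=> p0; apply: Omega1_plusZ => //; rewrite power_path0 gt_eqF// powR_gt0.
Qed.

(** The velocity is radial, and the square root of the volume is affine in [s]; so
    the speed is constant. *)
Lemma ebin_metric_power_path (x y s : R) : 0 < x + y * s ->
  ebin_metric (power_path x y q 0 s *: al) (power_path x y q 1 s *: al)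
    (power_path x y q 1 s *: al) = (y * q) ^+ 2 * m%:R * total_volume c0 al.
Proof.
move=> p0; rewrite /ebin_metric c0E /total_volume -(density_integralZ cptM); last first.
  apply: cont_on_vol; apply: cont_on_sub (Omega1_cont pal.1).
  exact: covered_dom.
apply: eq_density_integral => i p /covered_dom ip.
rewrite -[LHS]/(fiber_density (power_path x y q 0 s *: al i p)
  (power_path x y q 1 s *: al i p) (power_path x y q 1 s *: al i p)).
rewrite power_path_velocity// -scalerA fiber_density_diag; last first.
  exact: (Omega1_plus_gt0 (power_path_plus p0) ip).
rewrite volZ; last by rewrite power_path0 powR_ge0.
rewrite power_path0 powR_2_div_m ?ltW//.
by field; rewrite pnatr_eq0 -lt0n m0 gt_eqF.
Qed.

Lemma geodesic_dist_power_path (x z : R) : 0 < x -> 0 < z ->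
  (geodesic_dist ((x `^ q) *: al) ((z `^ q) *: al) <=
   (`|z - x| * (q * Num.sqrt (m%:R * total_volume c0 al)))%:E)%E.
Proof.
move=> x0 z0; set y := z - x.
have p0 s : s \in `[0, 1] -> 0 < x + y * s.
  rewrite in_itv/= => /andP[s0 s1].
  have -> : x + y * s = (1 - s) * x + s * z by rewrite /y; ring.
  have [->|sn1] := eqVneq s 1; first by rewrite subrr mul0r add0r mul1r.
  have s1' : 0 < 1 - s by rewrite subr_gt0 lt_neqAle sn1.
  by apply: ltr_pwDl; [exact: mulr_gt0|rewrite mulr_ge0// ltW].
pose c t := power_path x y q 0 t *: al; pose v t := power_path x y q 1 t *: al.
have cv : is_velocity `[0, 1] c v.
  apply: is_velocityZ; first exact: pal.1.
  by move=> t tI; apply: is_derive_power_path; exact: p0.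
have sc : smooth_curve `[0, 1] c.
  apply: (smooth_curveZ pal.1 (f := power_path x y q)) => k t tI.
  by apply: is_derive_power_path; exact: p0.
have q0 : 0 <= q by rewrite divr_ge0.
have len : curve_length c v =
    (`|z - x| * (q * Num.sqrt (m%:R * total_volume c0 al)))%:E.
  rewrite /curve_length (eq_integral (cst
    (`|z - x| * (q * Num.sqrt (m%:R * total_volume c0 al)))%:E)); last first.
    move=> t /set_mem/= tI; rewrite /= ebin_metric_power_path ?p0//; congr _%:E.
    rewrite -mulrA sqrtrM ?sqr_ge0// sqrtr_sqr normrM (ger0_norm q0).
    by rewrite -mulrA.
  have L01 : lebesgue_measure (`[0%R, 1%R]%classic : set R) = 1%E.
    by rewrite lebesgue_measure_itv/= lte_fin ltr01 oppr0 adde0.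
  by rewrite integral_cst// [X in (_ * X)%E](_ : _ = 1%E) ?mule1//; exact: L01.
rewrite -len; apply: ereal_inf_lbound; exists c, v; split=> //.
- by move=> t tI; apply: power_path_plus; exact: p0.
- by rewrite /c !power_path0 mulr0 mulr1 addr0 /y addrC subrK.
Qed.

(** The forms [(1 / (k + 1)) `^ q *: al] are a Cauchy sequence, because they lie on
    one radial path of finite length. Their volumes tend to [0], so a limit would
    have volume [0] by [curve_length_ge]. *)
Lemma not_metrically_complete : ~ metrically_complete M n.
Proof.
pose r (k : nat) : R := k.+1%:R^-1; have r0 k : 0 < r k by rewrite invr_gt0.
pose u k : field := (r k `^ q) *: al.
have up k : Omega1_plus M n (u k).
  by apply: Omega1_plusZ => //; rewrite gt_eqF// powR_gt0.
pose K := q * Num.sqrt (m%:R * total_volume c0 al).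
have K0 : 0 <= K by rewrite mulr_ge0 ?divr_ge0 ?sqrtr_ge0.
move=> /(_ u up)[e e0|a pa ua].
  have eK : 0 < e / (K + 1) by rewrite divr_gt0// ltr_wpDl.
  have [N _ NP] := near_infty_natSinv_lt (PosNum eK).
  exists N => k l Nk Nl.
  apply: (le_lt_trans (geodesic_dist_power_path (r0 k) (r0 l))).
  have rN j : (N <= j)%N -> r j < e / (K + 1) by move=> /NP.
  have kl : `|r l - r k| < e / (K + 1).
    have := rN k Nk; have := rN l Nl; have := r0 k; have := r0 l.
    by rewrite ltr_norml; set E := e / _; move=> *; apply/andP; split; lra.
  rewrite lte_fin -/K (@le_lt_trans _ _ (`|r l - r k| * (K + 1)))//.
    by rewrite ler_wpM2l// lerDl.
  by rewrite -ltr_pdivlMr// ltr_wpDl.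
set V0 := total_volume c0 al; set Va := total_volume c0 a.
have V00 : 0 < V0 by exact: total_volume_gt0.
have Va0 : 0 < Num.sqrt Va by rewrite sqrtr_gt0; exact: total_volume_gt0.
have sm : 0 < Num.sqrt (m%:R : R) by rewrite sqrtr_gt0 ltr0n.
have Vu k : Num.sqrt (total_volume c0 (u k)) = r k * Num.sqrt V0.
  rewrite total_volumeZ ?powR_ge0// powR_2_div_m ?ltW//.
  by rewrite sqrtrM ?sqr_ge0// sqrtr_sqr gtr0_norm.
have e0 : 0 < Num.sqrt Va / Num.sqrt m%:R by rewrite divr_gt0.
have near1 : \forall k \near \oo,
    (geodesic_dist (u k) a < (Num.sqrt Va / Num.sqrt m%:R)%:E)%E.
  have h : nbhs (0%E : \bar R) (fun x => x < (Num.sqrt Va / Num.sqrt m%:R)%:E)%E.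
    by apply: open_ereal_lt'; rewrite lte_fin.
  exact: ua _ h.
have sV0 : 0 < Num.sqrt V0 by rewrite sqrtr_gt0.
have d0 := divr_gt0 (divr_gt0 Va0 (ltr0Sn R 1)) sV0.
have near2 : \forall k \near \oo, r k < Num.sqrt Va / 2 / Num.sqrt V0.
  exact: near_infty_natSinv_lt (PosNum d0).
have [k [dk rk]] := filter_ex (filterI near1 near2).
have [_ [c [v [sc cv pc [ck ca] ->]]] len] := ereal_inf_lt dk.
have := curve_length_ge cptM M0 m0 c0E sc cv pc; rewrite ck ca Vu -/Va.
have : ((Num.sqrt m%:R / 2)%:E * curve_length c v <=
        (Num.sqrt m%:R / 2)%:E * (Num.sqrt Va / Num.sqrt m%:R)%:E)%E.
  by apply: lee_wpmul2l; [rewrite lee_fin divr_ge0 ?sqrtr_ge0|exact: ltW].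
move=> /[swap] /le_trans/[apply]; rewrite -EFinM lee_fin.
have -> : Num.sqrt m%:R / 2 * (Num.sqrt Va / Num.sqrt m%:R) = Num.sqrt Va / 2.
  by field; rewrite gt_eqF.
apply/negP; rewrite -ltNge ltrBrDr [ltRHS]splitr ltrD2l.
by rewrite -(ltr_pdivlMr _ _ sV0).
Qed.

End metric_incompleteness.

(** * Geodesic incompleteness *)

Section geodesic_incompleteness.
Context {R : realType} {m n : nat} (M : manifold R m).
Hypothesis cptM : compact [set: M].
Hypothesis M0 : [set: M] !=set0.
Hypothesis m0 : (0 < m)%N.
Local Notation field := (local_field M n).
Variable al : field.
Hypothesis pal : Omega1_plus M n al.
Variable c0 : adapted_cover M.
Hypothesis c0E : forall f, density_integral f = density_integral_along c0 f.

Local Notation q := (2 / m%:R : R).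
Local Notation J := (density_integral_along c0).

Lemma cont_family_reparam (V T T' : topologicalType) D
    (F : T -> idx M -> M -> V) (g : T' -> T) : continuous g ->
  cont_family_on D [set: T] F -> cont_family_on D [set: T'] (F \o g).
Proof.
move=> cg cF t i p _ ip.
have c1 : g z.1 @[z --> (t, p)] --> g t.
  apply: (@cvg_comp _ _ _ fst g); first exact: cvg_fst.
  exact: cg.
have hc : (g z.1, z.2) @[z --> (t, p)] --> (g t, p) by exact: (cvg_pair c1 cvg_snd).
exact: (cvg_comp _ _ hc (cF (g t) i p Logic.I ip)).
Qed.

Lemma density_integral_le f g : cont_on (covered c0) f -> cont_on (covered c0) g ->
  (forall i p, covered c0 i p -> f i p <= g i p) -> J f <= J g.
Proof.
move=> cf cg fg; have cNf := cont_onZ (a := -1) cf.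
rewrite -subr_ge0.
have -> : J g - J f = J (fun i p => g i p + -1 * f i p).
  by rewrite density_integralD// density_integralZ// mulN1r.
by apply: density_integral_ge0 => i p ip; rewrite mulN1r subr_ge0 fg.
Qed.

Lemma is_derive_inv (t : R) : t != 0 ->
  is_derive t (1 : R) (fun x => x^-1) (- t ^- 2).
Proof.
move=> t0.
have h : is_derive t (1 : R) (id : R -> R) 1 by exact: is_derive_id.
apply: DeriveDef; first by apply: derivableV.
by rewrite (@deriveV _ _ id)//= derive_val /GRing.scale/= mulr1.
Qed.

(** The geodesic that reaches the zero form at time [0]. *)
Definition ray (t : R) : field := power_path 0 1 q 0 t *: al.

Let ray_pos (t : R) : 0 < t -> 0 < 0 + 1 * t.
Proof. by rewrite add0r mul1r. Qed.

Lemma ray_smooth (I : set R) : (forall t, I t -> 0 < t) -> smooth_curve I ray.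
Proof.
move=> I0; apply: (smooth_curveZ pal.1 (f := power_path 0 1 q)) => k t It.
by apply: is_derive_power_path; exact/ray_pos/I0.
Qed.

Lemma ray_plus t : 0 < t -> Omega1_plus M n (ray t).
Proof. by move=> t0; apply: power_path_plus => //; exact: ray_pos. Qed.

Lemma ray_velocity (s t : R) (v : R -> field) : 0 < s -> s < t ->
  is_velocity `[s, t] ray v ->
  forall x, x \in `[s, t] -> v x = (q / x) *: ray x.
Proof.
move=> s0 st rv.
have I0 x : x \in `[s, t] -> 0 < x.
  by rewrite in_itv/= => /andP[sx _]; exact: lt_le_trans sx.
have rv0 : is_velocity `[s, t] ray (fun x => (q / x) *: ray x).
  apply: (@is_velocity_congr _ _ _ _ _ ray ray
    (fun t => power_path 0 1 q 1 t *: al)) => //.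
    move=> x /I0 x0; rewrite power_path_velocity ?ray_pos//.
    by rewrite add0r !mul1r scalerA.
  apply: is_velocityZ; first exact: pal.1.
  by move=> x /I0 x0; apply: is_derive_power_path; exact: ray_pos.
apply: (velocity_unique st _ rv rv0) => x /I0 x0.
exact: Omega1_cont (ray_plus x0).1.
Qed.

Section variation.
Variables (s t : R) (v h h' : R -> field).
Hypotheses (s0 : 0 < s) (st : s < t).
Hypotheses (rv : is_velocity `[s, t] ray v) (sh : smooth_curve `[s, t] h).
Hypotheses (hh' : is_velocity `[s, t] h h') (hs0 : h s = 0) (ht0 : h t = 0).

Let cl := clamp s t.

Let cl_itv x : cl x \in `[s, t].
Proof. exact/clamp_itv/ltW. Qed.

Let itv_gt0 x : x \in `[s, t] -> 0 < x.
Proof. by rewrite in_itv/= => /andP[sx _]; exact: lt_le_trans sx. Qed.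

Let cl_gt0 x : 0 < cl x.
Proof. exact: itv_gt0. Qed.

Let A (r : R) : R -> field := (ray \o cl) + r *: (h \o cl).
Let V (r : R) : R -> field := (v \o cl) + r *: (h' \o cl).
Let mu (x : R) : R := q / cl x.
Let k (x : R) : field := h' (cl x) - mu x *: h (cl x).

Let path_ray : C1_path s t (ray \o cl) (v \o cl).
Proof. by apply: smooth_curve_C1_path => //; apply: ray_smooth => x /itv_gt0. Qed.

Let path_h : C1_path s t (h \o cl) (h' \o cl).
Proof. exact: smooth_curve_C1_path. Qed.

Let path_A r : C1_path s t (A r) (V r).
Proof. exact: C1_pathD. Qed.

Let mu_continuous : continuous mu.
Proof.
move=> x; apply: cvgM; first exact: cvg_cst.
by apply: cvgV; [rewrite gt_eqF|exact: clamp_continuous].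
Qed.

(** The velocity of the unperturbed curve is [mu] times the curve itself, so that
    only a term of order [r] is left after removing the radial part. *)
Let V_radial r x i p : V r x i p - mu x *: A r x i p = r *: k x i p.
Proof.
rewrite /V /A /k !fctE /= (ray_velocity s0 st rv (cl_itv x)) !fctE.
rewrite !scalerDr opprD addrACA subrr add0r !scalerN !scalerA.
by rewrite (mulrC r).
Qed.

Let cont_k : cont_family_on (@dom _ _ M) [set: R] k.
Proof.
have [ch ch' _] := path_h.
move=> x i p xT ip; apply: cvgB; first exact: (ch' x i p xT ip).
apply: cvgZ; last exact: (ch x i p xT ip).
by apply: (@cvg_comp _ _ _ fst mu); [exact: cvg_fst|exact: mu_continuous].
Qed.

Let cont_A2 : cont_family_on (@dom _ _ M) [set: R * R] (fun w => A w.1 w.2).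
Proof.
have [cr _ _] := path_ray; have [ch _ _] := path_h.
have snd_cont : continuous (@snd R R) by move=> w; exact: cvg_snd.
have cr2 := cont_family_reparam snd_cont cr.
have ch2 := cont_family_reparam snd_cont ch.
move=> w i p wT ip; apply: cvgD; first exact: (cr2 w i p wT ip).
apply: cvgZ; last exact: (ch2 w i p wT ip).
by apply: (@cvg_comp _ _ _ fst fst); exact: cvg_fst.
Qed.

(** Compactness of [[s, t]] and of the closures of the cover makes the
    perturbed curve stay in the space for all small [r]. *)
Let full_rank_near : exists2 d : R, 0 < d & forall r, `|r| <= d ->
  forall x i p, covered c0 i p -> 0 < \det (gram (A r x i p)).
Proof.
have near_k (j : 'I_(cover_size c0)) : \forall r \near (0 : R),
    `[s, t] `*` closure (cover_set j) `<=`
    [set z | 0 < \det (gram (A r z.1 (cover_idx j) z.2))].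
  have cK : compact (`[s, t]%classic `*` closure (cover_set j)).
    apply: compact_setX; first exact: segment_compact.
    by apply: (subclosed_compact _ cptM) => //; exact: closed_closure.
  move: cK => /compact_near_coveringP cK.
  apply: (cK R (nbhs (0 : R))
    (fun r z => 0 < \det (gram (A r z.1 (cover_idx j) z.2)))).
  move=> [x p] [/= xI jp].
  have jd : dom (cover_idx j) p by exact: cover_closure.
  have d0 : 0 < \det (gram (A 0 x (cover_idx j) p)).
    rewrite /A scale0r addr0; apply: (Omega1_plus_gt0 _ jd).
    exact/ray_plus/cl_gt0.
  have cd := cvg_det (cvg_gram (cont_A2 (t := (0, x)) Logic.I jd)).
  have h1 : \forall w \near ((0, x), p),
      0 < \det (gram (A w.1.1 w.1.2 (cover_idx j) w.2)).
    exact: (cvgr_gt _ (cd _ _) _ d0).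
  have hc : ((z.2, z.1.1), z.1.2) @[z --> filter_prod (nbhs (x, p)) (nbhs (0 : R))]
      --> ((0 : R, x), p).
    set G := filter_prod _ _.
    have c1 : z.2 @[z --> G] --> (0 : R) by exact: cvg_snd.
    have c2 : z.1.1 @[z --> G] --> x.
      by apply: (@cvg_comp _ _ _ fst fst); exact: cvg_fst.
    have c3 : z.1.2 @[z --> G] --> p.
      by apply: (@cvg_comp _ _ _ fst snd); [exact: cvg_fst|exact: cvg_snd].
    exact: (cvg_pair (cvg_pair c1 c2) c3).
  exact: hc _ h1.
have near_all : \forall r \near (0 : R), forall j : 'I_(cover_size c0),
    `[s, t] `*` closure (cover_set j) `<=`
    [set z | 0 < \det (gram (A r z.1 (cover_idx j) z.2))].
  exact: (@filter_forall R 'I_(cover_size c0) (fun j r =>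
    `[s, t] `*` closure (cover_set j) `<=`
    [set z | 0 < \det (gram (A r z.1 (cover_idx j) z.2))]) (nbhs (0 : R)) _ near_k).
have /nbhs_ballP[e /= e0 eP] := near_all.
exists (e / 2); first by rewrite divr_gt0.
move=> r re x i p [j <- jp].
have rb : ball (0 : R) e r.
  by rewrite /ball/= sub0r normrN (le_lt_trans re)// gtr_pMr// invf_lt1// ltr1n.
have := eP r rb j (cl x, p) (conj (cl_itv x) jp) => /=.
by rewrite /A !fctE /= /cl clamp_id//; exact: cl_itv.
Qed.

(** With [mu = q / x] and [q = 2 / m], the volume terms of [energy_radial] are the
    exact derivative [2 q (W / x)'], and their integral only depends on the end
    points, where the perturbation vanishes. The remaining term has order [r ^+ 2]
    by [V_radial]. *)
Lemma first_variation : is_derive (0 : R) (1 : R)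
  (fun r : R => energy s t (ray + r *: h) (v + r *: h')) (0 : R).
Proof.
have [d d0 Apos] := full_rank_near.
have sub := @covered_dom _ _ _ c0.
have cA r : cont_family_on (covered c0) [set: R] (A r).
  by have [cA _ _] := path_A r; exact: cont_family_on_sub sub cA.
have cV r : cont_family_on (covered c0) [set: R] (V r).
  by have [_ cV _] := path_A r; exact: cont_family_on_sub sub cV.
have ck := cont_family_on_sub sub cont_k.
pose D r x i p := fiber_density (A r x i p) (k x i p) (k x i p).
have cD r : `|r| <= d -> cont_family_on (covered c0) [set: R] (D r).
  move=> rd; apply: cont_family_fiber_density; [|exact: cA|exact: ck|exact: ck].
  by move=> x i p _; exact: Apos.
have [C C0 DC] : exists2 C : R, 0 < C & forall r x, `|r| <= d -> x \in `[s, t] ->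
    forall i p, covered c0 i p -> D r x i p <= C.
  have cK : compact (`[- d, d]%classic `*` `[s, t]%classic).
    by apply: compact_setX; exact: segment_compact.
  have cD2 : cont_family_on (covered c0) (`[- d, d]%classic `*` `[s, t]%classic)
      (fun w => D w.1 w.2).
    have snd_cont : continuous (@snd R R) by move=> w; exact: cvg_snd.
    have ck2 := cont_family_reparam snd_cont ck.
    have cA2 := cont_family_on_sub sub cont_A2.
    apply: cont_family_fiber_density.
    + move=> [r x] i p [/= rI xI]; apply: Apos.
      by move: rI; rewrite in_itv/= ler_norml.
    + by move=> w i p _; exact: cA2.
    + by move=> w i p _; exact: ck2.
    + by move=> w i p _; exact: ck2.
  have [C C0 CP] := cont_family_bounded cptM cK cD2.
  exists C => // r x rd xI i p [j <- jp]; apply: (le_trans (ler_norm _)).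
  by apply: (CP (r, x) j p) => //; split=> //=; rewrite in_itv/= -ler_norml.
pose W r := volume c0 (A r); pose W' r := volume' c0 (A r) (V r).
pose Phi r x := 2 * mu x * W' r x - mu x ^+ 2 * m%:R * W r x.
pose Rem r x := J (D r x).
have cW r : `|r| <= d -> continuous (W r).
  by move=> rd; exact: (volume_continuous cptM (path_A r)).
have cW' r : `|r| <= d -> continuous (W' r).
  by move=> rd; exact: (volume'_continuous cptM (path_A r) (Apos r rd)).
have cRem r : `|r| <= d -> continuous (Rem r).
  by move=> rd; apply: continuous_density_integral => //; exact: cD.
have cPhi r : `|r| <= d -> continuous (Phi r).
  move=> rd x; apply: cvgB; apply: cvgM.
  - by apply: cvgM; [exact: cvg_cst|exact: mu_continuous].
  - exact: cW'.
  - by apply: cvgM; [apply: cvgM; exact: mu_continuous|exact: cvg_cst].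
  - exact: cW.
have metricE r x : `|r| <= d -> x \in `[s, t] ->
    ebin_metric ((ray + r *: h) x) ((v + r *: h') x) ((v + r *: h') x) =
    Phi r x + r ^+ 2 * Rem r x.
  move=> rd xI; rewrite /ebin_metric c0E.
  have cAx := cont_family_on_at (t := x) (cA r) Logic.I.
  have cVx := cont_family_on_at (t := x) (cV r) Logic.I.
  have cDx := cont_family_on_at (t := x) (cD r rd) Logic.I.
  have := energy_radial cptM cAx cVx (Apos r rd x) (mu x).
  have -> : (fun i p => fiber_density (A r x i p) (V r x i p) (V r x i p)) =
      ebin_density ((ray + r *: h) x) ((v + r *: h') x) ((v + r *: h') x).
    by apply/funext => i; apply/funext => p; rewrite /A /V !fctE /= /cl clamp_id.
  move=> ->; congr (_ + _); rewrite /Rem -density_integralZ//.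
  apply: eq_density_integral => i p _.
  by rewrite V_radial /D /fiber_density fiber_formZl fiber_formZr expr2 !mulrA.
have mR : m%:R != 0 :> R by rewrite pnatr_eq0 -lt0n.
have intPhi r : `|r| <= d -> \int[lebesgue_measure]_(x in `[s, t]) Phi r x =
    2 * q * (total_volume c0 (ray t) / t - total_volume c0 (ray s) / s).
  move=> rd; pose F x := 2 * q * (W r x * (cl x)^-1).
  have cF : continuous F.
    move=> x; apply: cvgM; first exact: cvg_cst.
    apply: cvgM; first exact: cW.
    by apply: cvgV; [rewrite gt_eqF|exact: clamp_continuous].
  have dF x : x \in `]s, t[ -> is_derive x (1 : R) F (Phi r x).
    move=> xI; have xI' : x \in `[s, t] by exact: subset_itv_oo_cc xI.
    have x0 := itv_gt0 xI'.
    have dW := is_derive_volume cptM (path_A r) (Apos r rd) xI.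
    have di : is_derive x (1 : R) (fun x => (cl x)^-1) (- x ^- 2).
      have nI : \forall y \near x, y^-1 = (cl y)^-1.
        have := near_in_itvoo xI; apply: filterS => y /subset_itv_oo_cc yI.
        by rewrite /cl clamp_id.
      apply: (@near_eq_is_derive R R R (fun y => y^-1) (fun y => (cl y)^-1) x 1 _ nI).
      by apply: is_derive_inv; rewrite gt_eqF.
    have dP := is_deriveM dW di.
    have dZ := @is_deriveZ R R R _ (2 * q) x 1 _ dP.
    apply: (is_derive_eq dZ); rewrite /GRing.scale/= /Phi /mu /W /W' /cl clamp_id//.
    by field; rewrite mR gt_eqF.
  have := FTC_continuous st cF (cPhi r rd) dF.
  (* the perturbation vanishes at both end points *)
  rewrite /Rintegral => ->; rewrite /= /F /W /volume /total_volume -mulrBr.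
  have clt : cl t = t by rewrite /cl clamp_id// in_itv/= lexx ltW.
  have cls : cl s = s by rewrite /cl clamp_id// in_itv/= lexx ltW.
  have AE x : A r x = ray (cl x) + r *: h (cl x) by [].
  have At : A r t = ray t by rewrite AE clt ht0 scaler0 addr0.
  have As : A r s = ray s by rewrite AE cls hs0 scaler0 addr0.
  by rewrite At As clt cls.
pose I r := \int[lebesgue_measure]_(x in `[s, t]) Rem r x.
have energyE r : `|r| <= d -> energy s t (ray + r *: h) (v + r *: h') =
    2^-1 * (2 * q * (total_volume c0 (ray t) / t - total_volume c0 (ray s) / s) +
    r ^+ 2 * I r).
  move=> rd; rewrite /energy /I; congr (_ * _).
  have iRem := continuous_integrable_segment s t (cRem r rd).
  have iPhi := continuous_integrable_segment s t (cPhi r rd).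
  have crRem : continuous (fun x => r ^+ 2 * Rem r x).
    by move=> x; apply: cvgM; [exact: cvg_cst|exact: cRem].
  have irRem := continuous_integrable_segment s t crRem.
  rewrite -(intPhi r rd) -RintegralZl//= -RintegralD//=.
  by apply: eq_Rintegral => x /set_mem/= xI; exact: metricE.
pose L : R := fine (lebesgue_measure (`[s, t]%classic : set R)).
apply: (@is_derive_quadratic _ _ (2^-1 * (J (fun _ _ => C) * L))).
have : \forall r \near (0 : R), `|0 - r| < d by exact: nbhsx_ballx.
apply: filterS => r; rewrite sub0r normrN => /ltW rd.
have d00 : `|0 : R| <= d by rewrite normr0 ltW.
rewrite (energyE r rd) (energyE 0 d00).
have quad (E0 x y : R) :
    2^-1 * (E0 + r ^+ 2 * x) - 2^-1 * (E0 + 0 ^+ 2 * y) = 2^-1 * x * r ^+ 2.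
  by ring.
rewrite quad.
rewrite normrM (ger0_norm (sqr_ge0 r)).
apply: ler_wpM2r; first exact: sqr_ge0.
rewrite normrM (@ger0_norm _ 2^-1) ?invr_ge0//.
apply: ler_wpM2l; first by rewrite invr_ge0.
rewrite /I.
have Rem0 x : 0 <= Rem r x.
  apply: density_integral_ge0 => i p ip.
  by rewrite mulr_ge0 ?sqrtr_ge0// fiber_form_ge0// gt_eqF// Apos.
rewrite ger0_norm; last exact: Rintegral_ge0.
rewrite -[J (fun _ _ => C) * L]/(J (fun _ _ => C) * fine (lebesgue_measure (`[s, t]%classic : set R))).
rewrite -Rintegral_cst//; apply: le_Rintegral => //.
- exact: continuous_integrable_segment (cRem r rd).
- by apply: continuous_integrable_segment => x; exact: cvg_cst.
- move=> x xI; apply: density_integral_le.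
  + exact: cont_family_on_at (cD r rd) Logic.I.
  + exact: cont_on_cst.
  + by move=> i p ip; exact: DC.
Qed.

End variation.

Lemma ray_geodesic : geodesic `]0, +oo[ ray.
Proof.
split.
- by apply: ray_smooth => t; rewrite /= in_itv/= andbT.
- by move=> t; rewrite /= in_itv/= andbT; exact: ray_plus.
- move=> s t st stI v rv h h' sh hh' hs ht; apply: first_variation => //.
  have sI : `[s, t]%classic s by rewrite /= in_itv/= lexx ltW.
  by have := stI s sI; rewrite /= in_itv/= andbT.
Qed.

(** Any extension of the ray would vanish at time [0]. *)
Lemma not_geodesically_complete : ~ geodesically_complete M n.
Proof.
move=> /(_ `]0, +oo[%classic ray)[|||c' [[Oc [D [D0 DS]]] pc _] c'E].
- exact: interval_open.
- exact: interval_is_interval.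
- exact: ray_geodesic.
have [p _] := M0; have [i ip] := dom_cover p.
have cv : is_velocity [set: R] c' (D 1%N).
  apply: (is_velocity_congr _ _ (DS 0%N)) => // t _; exact: D0.
have cc t : [set: R] t -> cont_on (@dom _ _ M) (c' t).
  by move=> _; apply: Omega1_cont; exact: Oc.
have c'0 : c' 0 i p = 0.
  apply/eqP; rewrite -normr_le0; apply/ler_addgt0Pl => e e0; rewrite addr0.
  have e20 : 0 < e / 2 by rewrite divr_gt0.
  have h2 := velocity_joint_continuity cc cv (t := 0) Logic.I ip e20.
  have h3 : \forall s \near (0 : R), `|c' s i p - c' 0 i p| < e / 2.
    have hc : (s, p) @[s --> (0 : R)] --> ((0 : R), p).
      exact: (cvg_pair (@cvg_id _ (nbhs (0 : R))) (cvg_cst p)).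
    have h3 : \forall s \near (0 : R), [set: R] s -> `|c' s i p - c' 0 i p| < e / 2.
      exact: hc _ h2.
    by apply: filterS h3 => s; apply.
  have q0 : 0 < q by rewrite divr_gt0 ?ltr0n.
  have N0 : 0 < `|al i p| + 1 by rewrite ltr_wpDl.
  have h4 : \forall s \near 0^'+, s `^ q < e / 2 / (`|al i p| + 1).
    by apply: (cvgr_lt _ (powR_cvg0 q0)); rewrite divr_gt0.
  have h5 : \forall s \near 0^'+, `|c' s i p - c' 0 i p| < e / 2.
    by apply: cvg_within.
  near (0 : R)^'+ => s.
  have s4 : s `^ q < e / 2 / (`|al i p| + 1) by near: s.
  have s5 : `|c' s i p - c' 0 i p| < e / 2 by near: s.
  have s0 : 0 < s by near: s; exact: nbhs_right_gt.
  have cs : c' s = ray s by apply: c'E; rewrite /= in_itv/= s0.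
  rewrite -(subKr (c' s i p) (c' 0 i p)) (splitr e).
  rewrite (le_trans (ler_normB _ _))// lerD// ?(ltW s5)//.
  rewrite cs /ray power_path0 add0r mul1r normrZ ger0_norm ?powR_ge0//.
  rewrite (@le_trans _ _ (s `^ q * (`|al i p| + 1)))//.
    by rewrite ler_wpM2l ?powR_ge0// lerDl.
  by rewrite -ler_pdivlMr// ltW.
have [_ inj] := pc 0 Logic.I.
have := inj i p ip (const_mx 1) 0; rewrite c'0 !mul0mx => /(_ erefl).
move=> /matrixP/(_ (Ordinal m0) ord0); rewrite !mxE => /eqP.
by rewrite oner_eq0.
Unshelve. all: by end_near. Qed.

End geodesic_incompleteness.

Theorem theorem4p9 (R : realType) (m n : nat) (M : manifold R m) :
  (0 < m)%N -> (m <= n)%N ->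
  [set: M]%classic !=set0%classic -> compact [set: M]%classic -> orientable M ->
  Omega1_plus M n !=set0%classic ->
  ~ metrically_complete M n /\ ~ geodesically_complete M n.
Proof.
move=> m0 _ M0 cptM _ [al pal].
have [c cE] := density_integral_cover cptM.
split; first exact: (not_metrically_complete cptM M0 m0 pal cE).
exact: (not_geodesically_complete cptM M0 m0 pal cE).
Qed.
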